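(* Let $w(x,y,\mu)$, $\mu=(\mu_1,\dots,\mu_p)$, be any $N$-degree truncated non-degenerate perturbation (as defined in the context) of a planar formal vector field $v(x,y)=-x\,\partial/\partial y+\text{h.o.t.}$ in the generalized saddle-node case ($2s<r_1$), and let $n$ and $j_1<j_2<\dots<j_n$ be the number and the increasing sequence attached to $(s,r_1,N)$ in the context. Then there exist an invertible reparametrization, a parametric time rescaling and parametric changes of state variables which transform $w$ into the $N$-degree truncated parametric normal form $$\dot x=\mu_s+\mu_{s+1}y+\sum_{i=1}^{n}(\alpha_{j_i}+\mu_{i+s+1})\,y^{j_i+1}+xy^{s}+\sum_{k=0}^{s-2}\mu_{k+1}xy^{k},$$ $$\dot y=-x+y^{s+1}+\sum_{k=0}^{s-2}\mu_{k+1}y^{k+1},$$ where the $\alpha_{j_i}$ are real constants, $\alpha_{j_i}=0$ for all $j_i<r_1$, and $\alpha_{r_1}\neq0$. Moreover this differential system is in Hamiltonian--Eulerian decomposition, i.e. the vector field equals $$A^1_0+\mu_sA^{-1}_{-1}+\mu_{s+1}A^{-1}_0+\sum_{i=1}^n(\alpha_{j_i}+\mu_{i+s+1})A^{-1}_{j_i}+B^0_s+\sum_{k=0}^{s-2}\mu_{k+1}B^0_k ,$$ with Hamiltonian terms $A^l_k$ and Eulerian terms $B^l_k$.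
   Context: Everything is formal (power series in $x,y$ and in the parameters $\mu=(\mu_1,\dots,\mu_p)$, real coefficients). Planar vector fields and differential systems are identified. Put $$A^l_k=\tfrac{k-l+1}{k+2}x^{l+1}y^{k-l}\tfrac{\partial}{\partial x}-\tfrac{l+1}{k+2}x^ly^{k-l+1}\tfrac{\partial}{\partial y}\ (-1\le l\le k+1),\qquad B^l_k=x^{l+1}y^{k-l}\tfrac{\partial}{\partial x}+x^ly^{k-l+1}\tfrac{\partial}{\partial y}\ (0\le l\le k).$$ In particular $A^1_0=-x\,\partial/\partial y$, $A^{-1}_k=y^{k+1}\partial/\partial x$ (also for $k=-1$), $B^0_k=xy^k\partial/\partial x+y^{k+1}\partial/\partial y$. Sums with upper limit below the lower limit are empty. Parametric deformation: $w(x,y,\mu)$ is a parametric deformation of $v(x,y)=-x\,\partial/\partial y+\text{h.o.t.}$ if $w(x,y,0)=v(x,y)$ (where $v$ vanishes at the origin). By invertible parametric state transformations it can be brought to the form $A^1_0a(\mu)+\sum_{k\ge-1}a_k(\mu)A^{-1}_k+\sum_{k\ge0}b_k(\mu)B^0_k$ with $a(0)=1$, $a_{-1}(0)=a_0(0)=b_0(0)=0$. It is assumed that some $a_k(0)\ne0$ and some $b_l(0)\neq0$ with $k,l\ge1$; $r_1=\min\{k\ge1: a_k(0)\ne0\}$, $s=\min\{l\ge1:b_l(0)\neq0\}$, and the generalized saddle-node case means $2s<r_1$. The number $r_1$ is updated during normalization: once $B^0_j$-terms ($j>s$) have been removed by state changes and time rescaling, $r_1$ denotes the smallest $k$ such that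 the coefficient of $A^{-1}_k$ at $\mu=0$ is nonzero. The $N$-degree truncated $(r_1-s+1)$-th level parametric normal form of the deformation, $N>r_1$, obtained by invertible parametric changes of state variables and parametric time rescaling, is $$w_N=A^1_0a(\mu)+\sum_{i=0}^{s-2}b_i(\mu)B^0_i+B^0_s+\alpha_{r_1}A^{-1}_{r_1}+\sum_{j=-1}^{N-1}a_j(\mu)A^{-1}_j,$$ where $a(0)=1$, $\alpha_{r_1}\ne0$ is a constant, $b_i(0)=0$ for $0\le i\le s-2$, $a_j(0)=0$ for $-1\le j\le r_1$, $a_{r_1+s^2+s}(\mu)=0$, $a_{k(s+1)+2s}(\mu)=0$ for all $k\ge0$, $k\ne s$, and, if $r_1=s(s+1)+2s$ and $r_2<2s^2+4s$, also $a_{s+r_2+s^2}(\mu)=0$. Here $r_2$ is the smallest $k>r_1$ such that the coefficient of $A^{-1}_k$ at $\mu=0$ is nonzero. ''$N$-degree truncated'' means that the terms $A^{-1}_j$ with $j\ge N$ of the normal form are discarded. The sequence $j_1<\dots<j_n$ (and the number $n$) is defined by $$\{j_1,\dots,j_n\}=\{j: 1\le j<N,\ j\ne r_1+s^2+s\}\setminus\{k(s+1)+2s: k\ne s,\ k\ge0\}\quad\text{if } r_1\neq s(s+1)+2s,$$ and $$\{j_1,\dots,j_n\}=\{j: 1\le j<N,\ j\ne 2s^2+4s,\ j\neq s+r_2+s^2\}\setminus\{k(s+1)+2s: k\ne s,\ k\ge0\}\quad\text{if } r_1=s(s+1)+2s\text{ and } r_2<2s^2+4s.$$ Only these two cases are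 considered. The ($N$-degree truncated) deformation is a non-degenerate perturbation if $\operatorname{rank}\big(\tfrac{\partial w_N}{\partial\mu}\big|_{\mu=0}\big)=n+s+1$, the rank being that of the linear map from parameter space to vector fields given by the derivative of $w_N$ with respect to $\mu$ at $\mu=0$.
   Formalization: Non-degeneracy is required for a normal form w_N whose coefficient a(μ) of A^1_0 has zero derivative at μ=0 (without this the claim fails, e.g. a=1+μ_1, b_0=0, s≥2), and r_1 is assumed not of the form k(s+1)+2s, k≠s, so that α_{r_1} is one of the α_{j_i}. *)

(* Defs.v *)
From HB Require Import structures.
From mathcomp Require Import all_boot all_order all_algebra.
From mathcomp Require Import boolp reals.
From mathcomp Require Import mpoly.

Set Implicit Arguments.
Unset Strict Implicit.
Unset Printing Implicit Defensive.

Import Order.TTheory GRing.Theory Num.Theory.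
Local Open Scope ring_scope.

(* A series is its family of coefficients: [f m] is the coefficient of the
   monomial [m].  In particular [f 0%MM] is the constant term. *)
Definition fps (R : Type) (n : nat) := 'X_{1..n} -> R.

HB.instance Definition _ R n := gen_eqMixin (fps R n).
HB.instance Definition _ R n := gen_choiceMixin (fps R n).

Section FpsRing.
Context (R : comNzRingType) (n : nat).
Implicit Types (f g h : fps R n) (m : 'X_{1..n}) (p q : {mpoly R[n]}).

Definition fps_mpoly p : fps R n := fun m => p@_m.

Definition fps_const (c : R) : fps R n := fps_mpoly c%:MP.

Definition fps_var (i : 'I_n) : fps R n := fps_mpoly 'X_i.

Definition fps_trunc (d : nat) f : {mpoly R[n]} :=
  \sum_(m : 'X_{1..n < d}) f m *: 'X_[m].

Definition fps_add f g : fps R n := fun m => f m + g m.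
Definition fps_opp f : fps R n := fun m => - f m.

(* The coefficient of [m] in a product only depends on the terms of degree
   at most [mdeg m] of the factors. *)
Definition fps_mul f g : fps R n := fun m =>
  (fps_trunc (mdeg m).+1 f * fps_trunc (mdeg m).+1 g)@_m.

Lemma fps_truncE d f m : (fps_trunc d f)@_m = if (mdeg m < d)%N then f m else 0.
Proof.
rewrite /fps_trunc; case: ltnP => lt_md; first by rewrite mcoeff_mpoly.
rewrite linear_sum /= big1 // => k _; rewrite mcoeffZ mcoeffX.
case: eqP => [eq_km|_]; last by rewrite mulr0.
by have := bmdeg k; rewrite eq_km ltnNge lt_md.
Qed.

Lemma mcoeffM_low p p' q q' m :
    (forall k, (mdeg k <= mdeg m)%N -> p@_k = p'@_k) ->
    (forall k, (mdeg k <= mdeg m)%N -> q@_k = q'@_k) ->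
  (p * q)@_m = (p' * q')@_m.
Proof.
move=> eqp eqq; rewrite !mcoeffM; apply: eq_bigr => k /eqP def_m.
have deg_m : (mdeg k.1 + mdeg k.2)%N = mdeg m by rewrite -mdegD -def_m.
rewrite eqp ?eqq //; first exact: leq_trans (leq_addl _ _) (eq_leq deg_m).
exact: leq_trans (leq_addr _ _) (eq_leq deg_m).
Qed.

Lemma fps_mulE d f g m : (mdeg m < d)%N ->
  fps_mul f g m = (fps_trunc d f * fps_trunc d g)@_m.
Proof.
move=> lt_md; apply: mcoeffM_low => k le_km;
  by rewrite !fps_truncE ltnS le_km (leq_ltn_trans le_km lt_md).
Qed.

Lemma fps_addA : associative fps_add.
Proof. by move=> f g h; apply/funext => m; rewrite /fps_add addrA. Qed.

Lemma fps_addC : commutative fps_add.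
Proof. by move=> f g; apply/funext => m; rewrite /fps_add addrC. Qed.

Lemma fps_add0 : left_id (fps_mpoly 0) fps_add.
Proof. by move=> f; apply/funext => m; rewrite /fps_add /fps_mpoly mcoeff0 add0r. Qed.

Lemma fps_addN : left_inverse (fps_mpoly 0) fps_opp fps_add.
Proof.
by move=> f; apply/funext => m; rewrite /fps_add /fps_mpoly mcoeff0 addNr.
Qed.

HB.instance Definition _ :=
  GRing.isZmodule.Build (fps R n) fps_addA fps_addC fps_add0 fps_addN.

Lemma fps_mulC : commutative fps_mul.
Proof. by move=> f g; apply/funext => m; rewrite /fps_mul mulrC. Qed.

Lemma fps_mulA : associative fps_mul.
Proof.
move=> f g h; apply/funext => m.
transitivity (fps_trunc (mdeg m).+1 f *
  (fps_trunc (mdeg m).+1 g * fps_trunc (mdeg m).+1 h))@_m; last rewrite mulrA.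
  apply: mcoeffM_low => // k le_km.
  by rewrite fps_truncE ltnS le_km; apply: fps_mulE.
apply: mcoeffM_low => // k le_km.
by rewrite fps_truncE ltnS le_km; apply/esym/fps_mulE.
Qed.

Lemma fps_mul1 : left_id (fps_mpoly 1) fps_mul.
Proof.
move=> f; apply/funext => m; rewrite /fps_mul.
transitivity (1 * fps_trunc (mdeg m).+1 f)@_m.
  apply: mcoeffM_low => // k le_km.
  by rewrite fps_truncE ltnS le_km.
by rewrite mul1r fps_truncE leqnn.
Qed.

Lemma fps_mulDl : left_distributive fps_mul fps_add.
Proof.
move=> f g h; apply/funext => m; rewrite /fps_mul /fps_add -mcoeffD -mulrDl.
by apply: mcoeffM_low => // k le_km; rewrite mcoeffD !fps_truncE ltnS le_km.
Qed.

Lemma fps_oner_neq0 : fps_mpoly 1 != fps_mpoly 0.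
Proof.
apply/eqP => /(congr1 (fun f : fps R n => f 0%MM)) /eqP.
by rewrite /fps_mpoly mcoeff1 mcoeff0 eqxx oner_eq0.
Qed.

HB.instance Definition _ := GRing.Zmodule_isComNzRing.Build (fps R n)
  fps_mulA fps_mulC fps_mul1 fps_mulDl fps_oner_neq0.

Definition fps_deriv (i : 'I_n) f : fps R n :=
  fun m => f (m + U_(i))%MM *+ (m i).+1.

(* [\sum_(i >= 0) F i] for a family such that [F i] has no monomial of degree
   < i, so that only finitely many terms contribute to each coefficient. *)
Definition fps_sum (F : nat -> fps R n) : fps R n :=
  fun m => \sum_(i < (mdeg m).+1) F i m.

End FpsRing.

Arguments fps_const {R n} c.
Arguments fps_var {R n} i.

(* [f(g_0, ..., g_(n-1))], for series [g i] without constant term; then the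
   coefficient of [m] only depends on the terms of degree at most [mdeg m]. *)
Definition fps_subst (R : comNzRingType) (n k : nat)
    (g : 'I_n -> fps R k) (f : fps R n) : fps R k := fun m =>
  (fps_trunc (mdeg m).+1 f \mPo [tuple fps_trunc (mdeg m).+1 (g i) | i < n])@_m.

(* Series in [x], [y], [mu_1 .. mu_p]: the variables [0] and [1] are [x] and
   [y], and the variable [rshift 2 i] is [mu_(i+1)].  A planar vector field is
   the column of its components along [d/dx] and [d/dy]. *)
Notation vfield R p := 'cV[fps R (2 + p)]_2.

Section VectorFields.
Context {R : realType} {p : nat}.
Implicit Types (u w : vfield R p) (f : fps R (2 + p)) (c : fps R p).

Definition xvar : fps R (2 + p) := fps_var (lshift p ord0).
Definition yvar : fps R (2 + p) := fps_var (lshift p ord_max).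

(* Numbered from 1: [mu i] is the parameter [mu_i] for 1 <= i <= p.  Other values
   of [i] are not used. *)
Definition mu (i : nat) : fps R (2 + p) :=
  if insub i.-1 is Some k then fps_var (rshift 2 k) else 0.

Definition cst (c : R) : fps R (2 + p) := fps_const c.

Definition par c : fps R (2 + p) := fps_subst (fun i => fps_var (rshift 2 i)) c.

Definition vf (f g : fps R (2 + p)) : vfield R p :=
  \col_(i < 2) if i == ord0 then f else g.

(* The exponents are the natural numbers [l + 1], [k - l], ... except for
   [l = -1] (resp. [l = k + 1]), where the one equal to [-1] comes with the
   coefficient 0. *)
Definition fA (l k : int) : vfield R p :=
  vf (cst ((k - l + 1)%:~R / (k + 2)%:~R)
        * xvar ^+ absz (l + 1) * yvar ^+ absz (k - l))
     (- (cst ((l + 1)%:~R / (k + 2)%:~R)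
        * xvar ^+ absz l * yvar ^+ absz (k - l + 1))).

Definition fB (l k : int) : vfield R p :=
  vf (xvar ^+ absz (l + 1) * yvar ^+ absz (k - l))
     (xvar ^+ absz l * yvar ^+ absz (k - l + 1)).

Definition hamiltonian u := exists H : fps R (2 + p),
  u = vf (fps_deriv (lshift p ord_max) H) (- fps_deriv (lshift p ord0) H).

Definition eulerian u := exists f : fps R (2 + p),
  u = vf (f * xvar) (f * yvar).

Definition vsum (F : nat -> vfield R p) : vfield R p :=
  \matrix_(i, j) fps_sum (fun k => F k i j).

Definition reparametrization (phi : 'I_p -> fps R p) :=
  (forall i, phi i 0%MM = 0) /\
  \det (\matrix_(i, j) fps_deriv j (phi i) 0%MM) != 0.

Definition state_jacobian (Phi : 'cV[fps R (2 + p)]_2) : 'M[fps R (2 + p)]_2 :=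
  \matrix_(i, j) fps_deriv (lshift p j) (Phi i 0).

(* [Phi] fixes the origin for [mu = 0], but not necessarily for the other values
   of the parameters. *)
Definition state_change (Phi : 'cV[fps R (2 + p)]_2) :=
  (forall i, Phi i 0 0%MM = 0) /\
  \det (\matrix_(i, j) state_jacobian Phi i j 0%MM) != 0.

Definition time_rescaling (T : fps R (2 + p)) := T 0%MM != 0.

Definition pull (phi : 'I_p -> fps R p) (Phi : 'cV[fps R (2 + p)]_2) w :
    vfield R p :=
  map_mx (fps_subst (fun i => match split i with
                              | inl j => Phi j 0
                              | inr j => par (phi j)
                              end)) w.

(* [w], in the variables [x, y], the parameters [mu] and the time [t], becomes
   [u], in the variables [X, Y], the parameters [nu] and the time [tau], when
   [(x, y) = Phi(X, Y, nu)], [mu = phi(nu)] and [dt = T(X, Y, nu) d tau]: the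
   chain rule gives
   [d(x, y)/d tau = D_(X,Y)Phi . d(X, Y)/d tau = T . w(Phi, phi(nu))]. *)
Definition transforms phi Phi T w u :=
  state_jacobian Phi *m u = T *: pull phi Phi w.

Definition at_mu0 (w : vfield R p) : 'cV[fps R 2]_2 :=
  map_mx (fps_subst (fun i => match split i with
                              | inl j => fps_var j
                              | inr _ => 0
                              end)) w.

Definition dmu0 (w : vfield R p) (v : 'rV[R]_p) : 'cV[fps R 2]_2 :=
  \sum_(i < p) fps_const (v 0 i) *:
     at_mu0 (map_mx (fps_deriv (rshift 2 i)) w).

Definition has_rank (L : 'rV[R]_p -> 'cV[fps R 2]_2) (r : nat) :=
  exists e : 'I_r -> 'cV[fps R 2]_2,
  [/\ forall i, exists v, e i = L v,
      forall c : 'I_r -> R, \sum_(i < r) fps_const (c i) *: e i = 0 ->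
        forall i, c i = 0
    & forall v, exists c : 'I_r -> R,
        L v = \sum_(i < r) fps_const (c i) *: e i].

(* [v = - x d/dy + h.o.t.] *)
Definition bt_singularity (v : 'cV[fps R 2]_2) :=
  forall (i : 'I_2) (m : 'X_{1..2}), (mdeg m <= 1)%N ->
    v i 0 m = if (i == ord_max) && (m == U_(ord0)%MM) then -1 else 0.

Definition deformation w (v : 'cV[fps R 2]_2) := at_mu0 w = v.

(* [2 s < r], where [s] and [r] are read off the form
   [a A^1_0 + \sum_(k >= -1) a_k A^(-1)_k + \sum_(k >= 0) b_k B^0_k]
   reached by changes of state variables only. *)
Definition generalized_saddle_node (s r : nat) w :=
  exists Phi (a : fps R p) (ak : int -> fps R p) (b : nat -> fps R p),
  [/\ state_change Phi /\ transforms fps_var Phi 1 w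
        (par a *: fA 1 0
         + vsum (fun i => par (ak (i%:Z - 1)) *: fA (-1) (i%:Z - 1))
         + vsum (fun i => par (b i) *: fB 0 i)),
      [/\ a 0%MM = 1, ak (-1) 0%MM = 0, ak 0 0%MM = 0 & b 0%N 0%MM = 0],
      [/\ (1 <= r)%N, ak r 0%MM != 0
        & forall k : nat, (1 <= k < r)%N -> ak k 0%MM = 0],
      [/\ (1 <= s)%N, b s 0%MM != 0
        & forall l : nat, (1 <= l < s)%N -> b l 0%MM = 0]
    & (2 * s < r)%N].

(* [j = k (s + 1) + 2 s] for some [k >= 0], [k <> s]. *)
Definition resonant (s j : nat) :=
  [exists k : 'I_j.+1, (k != s :> nat) && (j == k * s.+1 + 2 * s)%N].

(* The sequence [j_1 < ... < j_n]; [r2] is only used in the second case. *)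
Definition jseq (s r1 r2 N : nat) : seq nat :=
  if r1 != (s * s.+1 + 2 * s)%N then
    [seq j <- iota 1 N.-1 | (j != r1 + s ^ 2 + s)%N && ~~ resonant s j]
  else
    [seq j <- iota 1 N.-1 | [&& j != 2 * s ^ 2 + 4 * s, j != s + r2 + s ^ 2
                              & ~~ resonant s j]%N].

Definition nf_truncated (s r1 N : nat) (a : fps R p) (b : nat -> fps R p)
    (alpha : R) (aj : int -> fps R p) : vfield R p :=
  par a *: fA 1 0 + \sum_(i < s.-1) par (b i) *: fB 0 i + fB 0 s
  + cst alpha *: fA (-1) r1
  + \sum_(i < N.+1) par (aj (i%:Z - 1)) *: fA (-1) (i%:Z - 1).

(* [\sum_(j >= N) c_j A^(-1)_j], the terms which the truncation discards. *)
Definition nf_tail (N : nat) (c : nat -> fps R p) : vfield R p :=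
  vsum (fun i => par (c (N + i)%N) *: fA (-1) (N + i)%N).

(* Since [alpha != 0] and [A^(-1)_j] is absent from the normal form for
   resonant [j], [r1] is not resonant. *)
Definition nf_coefficients (s r1 r2 N : nat) (a : fps R p) (b : nat -> fps R p)
    (alpha : R) (aj : int -> fps R p) :=
  [/\ [/\ a 0%MM = 1, alpha != 0
        & forall i, (i < s.-1)%N -> b i 0%MM = 0],
      forall j : int, -1 <= j <= r1%:Z -> aj j 0%MM = 0,
      (r1 + s ^ 2 + s < N)%N -> aj (r1 + s ^ 2 + s)%N = 0,
      ~~ resonant s r1 /\
        (forall j : nat, (j < N)%N -> resonant s j -> aj j = 0)
    & r1 = (s * s.+1 + 2 * s)%N -> (r2 < 2 * s ^ 2 + 4 * s)%N ->
        (s + r2 + s ^ 2 < N)%N -> aj (s + r2 + s ^ 2)%N = 0].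

(* [r2] is the smallest [k > r1] such that the coefficient of [A^(-1)_k] of the
   normal form does not vanish for [mu = 0]; [c] gives the coefficients
   of index at least [N]. *)
Definition is_r2 (r1 r2 N : nat) (aj : int -> fps R p) (c : nat -> fps R p) :=
  let coef (k : nat) := if (k < N)%N then aj k 0%MM else c k 0%MM in
  [/\ (r1 < r2)%N, coef r2 != 0
    & forall k : nat, (r1 < k < r2)%N -> coef k = 0].

(* The coefficient [a] can be rescaled at will, so that a normal form, hence
   the rank of its derivative, is not determined by [w]: the rank
   is taken for a normal form whose coefficient [a] is equal to 1 up to terms
   of order 2 in [mu].  Without this normalization the direction [A^1_0] could
   make up for a missing one: for [s >= 2], [a = 1 + mu_1] and [b_0 = 0] the
   rank can be [n + s + 1], although the trace of the linear part at the
   equilibrium cannot be unfolded as in the case [b_0 = mu_1]. *)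
Definition nondegenerate_perturbation (s r1 r2 N : nat) w :=
  exists Phi T (a : fps R p) (b : nat -> fps R p) (alpha : R)
         (aj : int -> fps R p) (c : nat -> fps R p),
  [/\ [/\ state_change Phi, time_rescaling T
        & transforms fps_var Phi T w
            (nf_truncated s r1 N a b alpha aj + nf_tail N c)],
      nf_coefficients s r1 r2 N a b alpha aj,
      r1 = (s * s.+1 + 2 * s)%N ->
        is_r2 r1 r2 N aj c /\ (r2 < 2 * s ^ 2 + 4 * s)%N,
      forall i, fps_deriv i a 0%MM = 0
    & has_rank (dmu0 (nf_truncated s r1 N a b alpha aj))
        (size (jseq s r1 r2 N) + s + 1)].

(* [js] is the sequence [j_1 < ... < j_n], so that [j_i] is its item [i.-1]. *)
Definition target_system (s : nat) (js : seq nat) (alpha : nat -> R) :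
    vfield R p :=
  vf (mu s + mu s.+1 * yvar
      + \sum_(1 <= i < (size js).+1)
          (cst (alpha (nth 0%N js i.-1)) + mu (i + s + 1))
            * yvar ^+ (nth 0%N js i.-1).+1
      + xvar * yvar ^+ s + \sum_(k < s.-1) mu k.+1 * (xvar * yvar ^+ k))
     (- xvar + yvar ^+ s.+1 + \sum_(k < s.-1) mu k.+1 * yvar ^+ k.+1).

Definition hamiltonian_part (s : nat) (js : seq nat) (alpha : nat -> R) :
    vfield R p :=
  fA 1 0 + mu s *: fA (-1) (-1) + mu s.+1 *: fA (-1) 0
  + \sum_(1 <= i < (size js).+1)
      (cst (alpha (nth 0%N js i.-1)) + mu (i + s + 1))
        *: fA (-1) (nth 0%N js i.-1).

Definition eulerian_part (s : nat) : vfield R p :=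
  fB 0 s + \sum_(k < s.-1) mu k.+1 *: fB 0 k.

End VectorFields.

(* Main.v *)
From HB Require Import structures.
Require Import Defs.
From mathcomp Require Import all_boot all_order all_algebra.
From mathcomp Require Import boolp reals mpoly zify.
Import Order.TTheory GRing.Theory Num.Theory.
Local Open Scope ring_scope.
Set Implicit Arguments.
Unset Strict Implicit.
Unset Printing Implicit Defensive.

(** Nondegeneracy provides a normal form
    a A^1_0 + sum_i b_i B^0_i + B^0_s + alpha A^(-1)_r1 + sum_j a_j A^(-1)_j
    of the deformation, up to terms A^(-1)_j with j >= N.  It differs from the
    target system in two respects only: the factor a in front of A^1_0, and the
    coefficients, which are arbitrary series in the parameters where the target
    has the parameters themselves.

    The factor a is absorbed by the change of variable x = X / a(mu).  It divides
    A^1_0 by a, fixes the radial fields B^0_k and multiplies the shears A^(-1)_k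
    by a, so that the time need not be rescaled any further
    ([transforms_normal_form]).

    After this scaling the coefficients are the b_i and the series
    a (a_j + [j = r1] alpha); those with j >= 1 outside of j_1, ..., j_n vanish
    identically, which leaves exactly q = n + s + 1 of them.  Subtracting their
    values at mu = 0 gives q series psi_k without constant term
    ([new_parameter]), to be taken as new parameters.  This is possible because
    their differentials at 0 are linearly independent.  Indeed, a is stationary
    at mu = 0, so that a direction v along which every psi_k is stationary is one
    along which every coefficient of the normal form is stationary
    ([new_parameter_stationary]).  The derivative of the normal form thus factors
    through the q x p Jacobian matrix of psi; since its rank is q, so is the rank
    of that matrix ([has_rank_row_free]), and in particular q <= p.  Linear forms
    complete psi to p series with an invertible Jacobian matrix, and the formal
    inverse function theorem ([fps_inverse_function]) gives the
    reparametrization ([reparametrization_exists]).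

    The formal calculus on which this rests (substitution is a ring morphism,
    substitutions compose, the chain rule) is deduced from the corresponding
    facts on polynomials: a series is congruent to a polynomial up to any given
    order, and all the operations respect such congruences.  Power series
    equations are solved by iterating a map which gains one order at each
    step ([contraction_fixpoint]). *)

(** * Order of vanishing of a formal power series *)

Lemma mulr_telescope (S : pzRingType) (a b a' b' : S) :
  a * b - a' * b' = (a - a') * b + a' * (b - b').
Proof. by rewrite mulrBl mulrBr addrA subrK. Qed.

Section OrderFiltration.
Context {R : comNzRingType} {n : nat}.
Implicit Types (f g h : fps R n) (m : 'X_{1..n}) (p q : {mpoly R[n]}).

Lemma fpsD f g m : (f + g) m = f m + g m. Proof. by []. Qed.
Lemma fpsN f m : (- f) m = - f m. Proof. by []. Qed.
Lemma fpsB f g m : (f - g) m = f m - g m. Proof. by []. Qed.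

Lemma fps0 m : (0 : fps R n) m = 0.
Proof. exact: mcoeff0. Qed.

Lemma fps1_0 : (1 : fps R n) 0%MM = 1.
Proof. by rewrite [LHS]mcoeff1 eqxx. Qed.

Lemma fps_sumE (I : Type) (r : seq I) (P : pred I) (F : I -> fps R n) m :
  (\sum_(i <- r | P i) F i) m = \sum_(i <- r | P i) F i m.
Proof.
exact: (big_morph (fun f : fps R n => f m) (fun f g => fpsD f g m) (fps0 m)).
Qed.

Lemma fpsM f g m :
  (f * g) m = \sum_(k : 'X_{1..n < (mdeg m).+1, (mdeg m).+1} |
                     m == (k.1 + k.2)%MM) f k.1 * g k.2.
Proof.
rewrite [LHS]mcoeffM; apply: eq_bigr => k _.
by rewrite !fps_truncE !bmdeg.
Qed.

(** The d-th power of the ideal of series without constant term; f and g agree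
    up to order d when [vanish d (f - g)]. *)
Definition vanish (d : nat) f := forall m, (mdeg m < d)%N -> f m = 0.

Lemma vanish_le d e f : (d <= e)%N -> vanish e f -> vanish d f.
Proof. by move=> led vf m ltm; apply: vf; apply: leq_trans led. Qed.

Lemma vanish0 d : vanish d 0.
Proof. by move=> m _; rewrite fps0. Qed.

Lemma vanishD d f g : vanish d f -> vanish d g -> vanish d (f + g).
Proof. by move=> vf vg m ltm; rewrite fpsD vf ?vg ?addr0. Qed.

Lemma vanishN d f : vanish d f -> vanish d (- f).
Proof. by move=> vf m ltm; rewrite fpsN vf ?oppr0. Qed.

Lemma vanishB d f g : vanish d f -> vanish d g -> vanish d (f - g).
Proof. by move=> vf vg; apply/vanishD/vanishN. Qed.

Lemma vanishC d f g : vanish d (f - g) -> vanish d (g - f).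
Proof. by move=> /vanishN; rewrite opprB. Qed.

Lemma vanish_trans d g f h : vanish d (f - g) -> vanish d (g - h) ->
  vanish d (f - h).
Proof. by move=> v1 v2; have := vanishD v1 v2; rewrite addrA subrK. Qed.

Lemma vanish_sum d (I : Type) (r : seq I) (P : pred I) (F : I -> fps R n) :
  (forall i, P i -> vanish d (F i)) -> vanish d (\sum_(i <- r | P i) F i).
Proof.
by move=> vF; elim/big_rec: _ => [|i f Pi vf];
  [exact: vanish0 | apply: vanishD; [exact: vF|]].
Qed.

Lemma vanish_any f : vanish 0 f.
Proof. by []. Qed.

(** A monomial of degree less than d + e only splits into a pair of monomials
    one of which has degree less than d, or less than e. *)
Lemma vanishM d e f g : vanish d f -> vanish e g -> vanish (d + e) (f * g).
Proof.
move=> vf vg m ltm; rewrite fpsM big1 // => k /eqP def_m.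
have [ltd|led] := ltnP (mdeg k.1) d; first by rewrite vf ?mul0r.
rewrite vg ?mulr0 //; rewrite def_m mdegD in ltm.
by have := leq_ltn_trans (leq_add led (leqnn _)) ltm; rewrite ltn_add2l.
Qed.

Lemma vanishMl d f g : vanish d f -> vanish d (f * g).
Proof. by move=> vf; have := vanishM vf (@vanish_any g); rewrite addn0. Qed.

Lemma vanishMr d f g : vanish d g -> vanish d (f * g).
Proof. by rewrite mulrC; apply: vanishMl. Qed.

Lemma vanishX f k : vanish 1 f -> vanish k (f ^+ k).
Proof.
move=> vf; elim: k => [|k IHk]; first exact: vanish_any.
by rewrite exprS -add1n; apply: vanishM.
Qed.

Lemma vanish1P f : vanish 1 f <-> f 0%MM = 0.
Proof.
split=> [vf|f0 m]; first by apply: vf; rewrite mdeg0.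
by rewrite ltnS leqn0 mdeg_eq0 => /eqP ->.
Qed.

Lemma vanish_eq f g : (forall d, vanish d (f - g)) -> f = g.
Proof.
move=> vfg; apply/funext => m; apply/eqP; rewrite -subr_eq0.
by apply/eqP/(vfg (mdeg m).+1).
Qed.

Lemma fps_mpolyD : {morph (@fps_mpoly R n) : p q / p + q}.
Proof. by move=> p q; apply/funext => m; rewrite fpsD /fps_mpoly mcoeffD. Qed.

Lemma fps_mpolyM : {morph (@fps_mpoly R n) : p q / p * q}.
Proof.
move=> p q; apply/funext => m; apply: mcoeffM_low => k le_km;
  by rewrite fps_truncE ltnS le_km.
Qed.

Fact fps_mpoly_is_nmod_morphism : nmod_morphism (@fps_mpoly R n).
Proof. by split; [by []|exact: fps_mpolyD]. Qed.
Fact fps_mpoly_is_monoid_morphism : monoid_morphism (@fps_mpoly R n).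
Proof. by split; [by []|exact: fps_mpolyM]. Qed.

HB.instance Definition _ := GRing.isNmodMorphism.Build _ _ (@fps_mpoly R n)
  fps_mpoly_is_nmod_morphism.
HB.instance Definition _ := GRing.isMonoidMorphism.Build _ _ (@fps_mpoly R n)
  fps_mpoly_is_monoid_morphism.
HB.instance Definition _ :=
  GRing.RMorphism.copy (@fps_const R n) (@fps_mpoly R n \o @mpolyC n R).

Lemma vanish_trunc d f : vanish d (f - fps_mpoly (fps_trunc d f)).
Proof. by move=> m ltm; rewrite fpsB /fps_mpoly fps_truncE ltm subrr. Qed.

Lemma fps_constE c m : fps_const c m = if m == 0%MM then c else 0 :> R.
Proof.
by rewrite /fps_const /fps_mpoly mcoeffC eq_sym;
  case: eqP; rewrite ?mulr1 ?mulr0.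
Qed.

Lemma fps_var0 (i : 'I_n) : fps_var i 0%MM = 0 :> R.
Proof.
rewrite /fps_var /fps_mpoly mcoeffX; case: eqP => // /(congr1 mdeg).
by rewrite mdeg1 mdeg0.
Qed.

Lemma fpsM0 f g : (f * g) 0%MM = f 0%MM * g 0%MM.
Proof.
rewrite {1}(_ : f = fps_const (f 0%MM) + (f - fps_const (f 0%MM))); last first.
  by rewrite addrC subrK.
rewrite mulrDl fpsD [X in _ + X](vanish1P _).1 ?addr0; last first.
  apply: vanishMl; apply/vanish1P.
  by rewrite fpsB fps_constE eqxx subrr.
rewrite {1}(_ : g = fps_const (g 0%MM) + (g - fps_const (g 0%MM))); last first.
  by rewrite addrC subrK.
rewrite mulrDr fpsD [X in _ + X](vanish1P _).1 ?addr0; last first.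
  apply: vanishMr; apply/vanish1P.
  by rewrite fpsB fps_constE eqxx subrr.
by rewrite -rmorphM /= fps_constE eqxx.
Qed.

(** The constant coefficient, named to carry its ring morphism structure. *)
Definition constcoef f : R := f 0%MM.
Fact constcoef_is_nmod_morphism : nmod_morphism constcoef.
Proof. by split; [exact: fps0|]. Qed.
Fact constcoef_is_monoid_morphism : monoid_morphism constcoef.
Proof. by split; [exact: fps1_0|exact: fpsM0]. Qed.
HB.instance Definition _ := GRing.isNmodMorphism.Build _ _ constcoef
  constcoef_is_nmod_morphism.
HB.instance Definition _ := GRing.isMonoidMorphism.Build _ _ constcoef
  constcoef_is_monoid_morphism.

End OrderFiltration.

Arguments vanish_trunc {R n} d f.
Arguments vanish_any {R n} f.

(** * Substitution *)

Section Substitution.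
Context {R : comNzRingType} {n k : nat}.
Implicit Types (f h : fps R n) (p q : {mpoly R[n]}).
Notation peval g p := (mmap (@fps_const R k) g p).

(** For products of k series without constant term, replacing each factor by one
    that agrees with it up to order e + 1 only changes terms of order at least
    e + k: each of the k terms of the telescoping sum keeps k - 1 of the factors.
    For k >= 2 this gains an order over the hypothesis, which makes
    [fps_subst_contract] a contraction. *)
Lemma mmap1_congr e (g g' : 'I_n -> fps R k) m :
    (forall i, vanish 1 (g i)) -> (forall i, vanish 1 (g' i)) ->
    (forall i, vanish e.+1 (g i - g' i)) ->
  [/\ vanish (mdeg m) (mmap1 g m), vanish (mdeg m) (mmap1 g' m)
    & vanish (e + mdeg m) (mmap1 g m - mmap1 g' m)].
Proof.
move=> vg vg' vgg'; pose Q d (f f' : fps R k) :=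
  [/\ vanish d f, vanish d f' & vanish (e + d) (f - f')].
have QM d d' (f f' h h' : fps R k) :
    Q d f f' -> Q d' h h' -> Q (d + d')%N (f * h) (f' * h').
  move=> [vf vf' vff'] [vh vh' vhh']; split; try exact: vanishM.
  apply: (@vanish_trans _ _ _ (f' * h)).
    by rewrite -mulrBl addnA; apply: vanishM.
  by rewrite -mulrBr addnCA; apply: vanishM.
have Q1 : Q 0%N 1 1 by split; rewrite ?subrr; try exact: vanish_any; exact: vanish0.
rewrite -/(Q _ _ _) mdegE /mmap1; elim/big_rec3: _ => [//|i y1 y2 y3 _ Qy].
apply: (QM) Qy.
elim: (m i) => [|d IHd]; first by rewrite !expr0.
by rewrite !exprS -add1n; apply: (QM) IHd; split; rewrite ?addn1.
Qed.

Lemma peval_congr d (g g' : 'I_n -> fps R k) p :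
    (forall i, vanish 1 (g i)) -> (forall i, vanish 1 (g' i)) ->
    (forall i, vanish d (g i - g' i)) ->
  vanish d (peval g p - peval g' p).
Proof.
case: d => [|e] vg vg' vgg'; first exact: vanish_any.
rewrite /mmap -sumrB; apply: vanish_sum => m _; rewrite -mulrBr.
apply: vanishMr; have [-> | nz_m] := eqVneq m 0%MM.
  by rewrite !mmap11 subrr; apply: vanish0.
have [_ _] := mmap1_congr m vg vg' vgg'; apply: vanish_le.
by rewrite -addn1 leq_add2l lt0n mdeg_eq0.
Qed.

Lemma vanish_peval d (g : 'I_n -> fps R k) p :
  (forall i, vanish 1 (g i)) -> vanish d (fps_mpoly p) -> vanish d (peval g p).
Proof.
move=> vg vp; rewrite /mmap; apply: vanish_sum => m _.
have [ltm|lem] := ltnP (mdeg m) d.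
  by rewrite [p@_m]vp // rmorph0 mul0r; apply: vanish0.
apply: vanishMr; apply: vanish_le lem _.
have vg0 i : vanish 1 (g i - g i) by rewrite subrr; exact: vanish0.
by have [] := @mmap1_congr 0%N g g m vg vg vg0.
Qed.

(** The link between substitution in a series, defined coefficientwise by
    truncation, and evaluation of polynomials in the ring of series: up to
    order d, a series may be replaced by any polynomial congruent to it. *)
Lemma fps_subst_approx d (g : 'I_n -> fps R k) f p :
    (forall i, vanish 1 (g i)) -> vanish d (f - fps_mpoly p) ->
  vanish d (fps_subst g f - peval g p).
Proof.
move=> vg vfp m ltm; set e := (mdeg m).+1.
have fmE : fps_subst g f m
    = peval (fun i => fps_mpoly (fps_trunc e (g i))) (fps_trunc e f) m.
  rewrite /fps_subst -/e comp_mpolyE -[LHS]/(fps_mpoly _ _) rmorph_sum /=.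
  congr (_ m); rewrite /mmap; apply: eq_bigr => j _.
  rewrite -mul_mpolyC rmorphM rmorph_prod /mmap1.
  by under eq_bigr do rewrite tnth_mktuple rmorphXn.
rewrite fpsB fmE -fpsB.
have vtr i : vanish e (fps_mpoly (fps_trunc e (g i)) - g i).
  exact/vanishC/vanish_trunc.
apply: (@vanish_trans _ _ e (peval g (fps_trunc e f))) (ltnSn _).
  apply: peval_congr => // i; apply/vanish1P.
  have /vanish1P := vanish_le (ltn0Sn _) (vtr i).
  by rewrite fpsB ((vanish1P (g i)).1 (vg i)) subr0.
rewrite -raddfB; apply: vanish_peval => //; rewrite raddfB.
apply: vanish_trans (vanish_le ltm vfp).
exact/vanishC/vanish_trunc.
Qed.

Lemma fps_subst_mpoly (g : 'I_n -> fps R k) p : (forall i, vanish 1 (g i)) ->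
  fps_subst g (fps_mpoly p) = peval g p.
Proof.
move=> vg; apply: vanish_eq => d; apply: fps_subst_approx => //.
by rewrite subrr; apply: vanish0.
Qed.

Section Morphism.
Variable g : 'I_n -> fps R k.
Hypothesis vg : forall i, vanish 1 (g i).

Lemma fps_substD : {morph fps_subst g : f h / f + h}.
Proof.
move=> f h; apply: vanish_eq => d.
pose p := fps_trunc d f; pose q := fps_trunc d h.
apply: (@vanish_trans _ _ _ (peval g (p + q))).
  apply: fps_subst_approx => //; rewrite rmorphD opprD addrACA.
  by apply: vanishD; apply: vanish_trunc.
rewrite rmorphD /= opprD addrACA.
by apply: vanishD; apply: vanishC; apply: fps_subst_approx => //;
  exact: vanish_trunc.
Qed.

Lemma fps_substM : {morph fps_subst g : f h / f * h}.
Proof.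
move=> f h; apply: vanish_eq => d.
pose p := fps_trunc d f; pose q := fps_trunc d h.
have vp : vanish d (f - fps_mpoly p) by exact: vanish_trunc.
have vq : vanish d (h - fps_mpoly q) by exact: vanish_trunc.
apply: (@vanish_trans _ _ _ (peval g (p * q))).
  apply: fps_subst_approx => //; rewrite rmorphM mulr_telescope.
  by apply: vanishD; [apply: vanishMl|apply: vanishMr].
rewrite rmorphM /= mulr_telescope.
by apply: vanishD; [apply: vanishMl|apply: vanishMr]; apply: vanishC;
  apply: fps_subst_approx.
Qed.

Lemma fps_substC c : fps_subst g (fps_const c) = fps_const c.
Proof. by rewrite /fps_const fps_subst_mpoly // mmapC. Qed.

Lemma fps_subst_var i : fps_subst g (fps_var i) = g i.
Proof. by rewrite /fps_var fps_subst_mpoly // mmapX mmap1U. Qed.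

Fact fps_subst_is_nmod_morphism : nmod_morphism (fps_subst g).
Proof. by split; [have := fps_substC 0; rewrite !rmorph0|exact: fps_substD]. Qed.
Fact fps_subst_is_monoid_morphism : monoid_morphism (fps_subst g).
Proof. by split; [have := fps_substC 1; rewrite !rmorph1|exact: fps_substM]. Qed.

(** Substitution is a morphism only for series [g i] without constant term, hence
    a bundled morphism that depends on the hypothesis. *)
Definition subst_rmorphism : {rmorphism fps R n -> fps R k} :=
  HB.pack (fps_subst g)
    (GRing.isNmodMorphism.Build _ _ (fps_subst g) fps_subst_is_nmod_morphism)
    (GRing.isMonoidMorphism.Build _ _ (fps_subst g) fps_subst_is_monoid_morphism).

Lemma fps_subst_rmorphE : fps_subst g = subst_rmorphism.
Proof. by []. Qed.

Lemma vanish_subst d f : vanish d f -> vanish d (fps_subst g f).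
Proof.
move=> vf; rewrite -[fps_subst _ _]subr0 -[0](mmap0 g (@fps_const R k)).
by apply: fps_subst_approx => //; rewrite rmorph0 subr0.
Qed.

Lemma fps_subst0 f : fps_subst g f 0%MM = f 0%MM.
Proof.
rewrite -{1}[f](subrK (fps_const (f 0%MM))) fps_substD fps_substC fpsD.
rewrite fps_constE eqxx [X in X + _](vanish1P _).1 ?add0r //.
apply: vanish_subst; apply/vanish1P.
by rewrite fpsB fps_constE eqxx subrr.
Qed.
End Morphism.

Lemma fps_subst_eq (g g' : 'I_n -> fps R k) f :
  g =1 g' -> fps_subst g f = fps_subst g' f.
Proof. by move=> /funext ->. Qed.

(** The contraction behind the inverse function theorem: a series of order at
    least 2 improves by one the order up to which its arguments agree. *)
Lemma fps_subst_contract e (g g' : 'I_n -> fps R k) f :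
    (forall i, vanish 1 (g i)) -> (forall i, vanish 1 (g' i)) ->
    (forall i, vanish e.+1 (g i - g' i)) -> vanish 2 f ->
  vanish e.+2 (fps_subst g f - fps_subst g' f).
Proof.
move=> vg vg' vgg' vf; have vp := vanish_trunc e.+2 f.
apply: vanish_trans (fps_subst_approx vg vp) _; apply: vanishC.
apply: vanish_trans (fps_subst_approx vg' vp) _; apply: vanishC.
rewrite /mmap -sumrB; apply: vanish_sum => m _; rewrite -mulrBr.
have [ltm|lem] := ltnP (mdeg m) 2.
  by rewrite fps_truncE vf // if_same rmorph0 mul0r; apply: vanish0.
apply: vanishMr; have [_ _] := mmap1_congr m vg vg' vgg'.
by apply: vanish_le; rewrite -addn2 leq_add2l.
Qed.
End Substitution.

Lemma mpoly_alg_ind (R : comNzRingType) n (K : {mpoly R[n]} -> Prop) :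
    (forall c, K c%:MP) -> (forall i, K 'X_i) ->
    (forall p q, K p -> K q -> K (p + q)) ->
    (forall p q, K p -> K q -> K (p * q)) ->
  forall p, K p.
Proof.
move=> KC KX KD KM p; rewrite [p]mpolyE.
have K1 : K 1 by rewrite -mpolyC1; apply: KC.
apply: (big_ind K) => [||m _]; [by rewrite -mpolyC0|exact: KD|].
rewrite -mul_mpolyC; apply: (KM); first exact: KC.
rewrite mpolyXE_id.
apply: (big_ind K) => [||i _]; [exact: K1|exact: KM|]; elim: (m i) => [//|d Kd].
by rewrite exprS; apply: KM.
Qed.

Section Composition.
Context {R : comNzRingType} {n k l : nat}.

Lemma fps_subst_comp (g : 'I_n -> fps R k) (h : 'I_k -> fps R l) f :
    (forall i, vanish 1 (g i)) -> (forall i, vanish 1 (h i)) ->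
  fps_subst h (fps_subst g f) = fps_subst (fun i => fps_subst h (g i)) f.
Proof.
move=> vg vh; have vhg i : vanish 1 (fps_subst h (g i)) by apply: vanish_subst.
apply: vanish_eq => d; have vp := vanish_trunc d f.
apply: vanish_trans (vanishC (fps_subst_approx vhg vp)).
rewrite [mmap _ _ _](_ : _ = fps_subst h (mmap fps_const g (fps_trunc d f))).
  rewrite !(fps_subst_rmorphE vh) -rmorphB; apply: vanish_subst => //.
  exact: fps_subst_approx.
elim/mpoly_alg_ind: (fps_trunc d f) => [c|i|p q Kp Kq|p q Kp Kq].
- by rewrite !mmapC fps_substC.
- by rewrite !mmapX !mmap1U.
- by rewrite !rmorphD /= Kp Kq fps_substD.
- by rewrite !rmorphM /= Kp Kq fps_substM.
Qed.
End Composition.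

(** * Derivations and the chain rule *)

Section Derivation.
Context {R : comNzRingType} {n : nat}.
Implicit Types (f g h : fps R n) (p q : {mpoly R[n]}) (i : 'I_n).

Lemma fps_derivD i f g : fps_deriv i (f + g) = fps_deriv i f + fps_deriv i g.
Proof. by apply/funext => m; rewrite fpsD /fps_deriv fpsD mulrnDl. Qed.

Lemma fps_deriv_is_nmod_morphism i :
  nmod_morphism (fps_deriv i : fps R n -> fps R n).
Proof.
split=> [|f g]; last exact: fps_derivD.
by apply/funext => m; rewrite /fps_deriv !fps0 mul0rn.
Qed.
HB.instance Definition _ i :=
  GRing.isNmodMorphism.Build (fps R n) (fps R n) (@fps_deriv R n i)
  (@fps_deriv_is_nmod_morphism i).

Lemma fps_deriv_mpoly i p : fps_deriv i (fps_mpoly p) = fps_mpoly p^`M(i).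
Proof. by apply/funext => m; rewrite /fps_mpoly mcoeff_mderiv. Qed.

Lemma fps_derivC i (c : R) : fps_deriv i (fps_const c : fps R n) = 0.
Proof. by rewrite /fps_const fps_deriv_mpoly mderivC rmorph0. Qed.

Lemma mderivXU i j : ('X_j)^`M(i) = (i == j)%:R :> {mpoly R[n]}.
Proof.
rewrite mderivX mnm1E eq_sym; case: eqP => [->|_]; last by rewrite scale0r.
rewrite scale1r [X in 'X_[X]](_ : _ = 0%MM) ?mpolyX0 //.
by apply/mnmP => l; rewrite mnmBE subnn mnm0E.
Qed.

Lemma fps_deriv_var i j : fps_deriv i (fps_var j) = (i == j)%:R :> fps R n.
Proof.
by rewrite /fps_var fps_deriv_mpoly mderivXU rmorph_nat.
Qed.

(** A derivation loses one order, whence the truncations at order d + 1 in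
    the proofs of the product rule and of the chain rule. *)
Lemma vanish_deriv d i f : vanish d.+1 f -> vanish d (fps_deriv i f).
Proof.
by move=> vf m ltm; rewrite /fps_deriv vf ?mul0rn // mdegD mdeg1 addn1.
Qed.

Lemma fps_derivM i f g :
  fps_deriv i (f * g) = fps_deriv i f * g + f * fps_deriv i g.
Proof.
apply: vanish_eq => d.
pose p := fps_trunc d.+1 f; pose q := fps_trunc d.+1 g.
have vp : vanish d.+1 (f - fps_mpoly p) by exact: vanish_trunc.
have vq : vanish d.+1 (g - fps_mpoly q) by exact: vanish_trunc.
apply: (@vanish_trans _ _ _ (fps_deriv i (fps_mpoly (p * q)))).
  rewrite -raddfB; apply: vanish_deriv; rewrite rmorphM mulr_telescope.
  by apply: vanishD; [apply: vanishMl|apply: vanishMr].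
rewrite fps_deriv_mpoly mderivM rmorphD !rmorphM /= -!fps_deriv_mpoly.
have vp' := vanish_deriv i vp; have vq' := vanish_deriv i vq.
rewrite raddfB in vp'; rewrite raddfB in vq'.
apply: vanishC; rewrite opprD addrACA !mulr_telescope.
by do !apply: vanishD; [apply: vanishMl|apply: vanishMr|apply: vanishMl
  |apply: vanishMr] => //; apply: vanish_le (leqnSn _) _.
Qed.

End Derivation.

Lemma fps_deriv_subst (R : comNzRingType) n k (g : 'I_n -> fps R k) f j :
    (forall i, vanish 1 (g i)) ->
  fps_deriv j (fps_subst g f)
    = \sum_i fps_subst g (fps_deriv i f) * fps_deriv j (g i).
Proof.
move=> vg; apply: vanish_eq => d.
pose p := fps_trunc d.+1 f.
have vp : vanish d.+1 (f - fps_mpoly p) by exact: vanish_trunc.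
apply: (@vanish_trans _ _ _ (fps_deriv j (fps_subst g (fps_mpoly p)))).
  rewrite -raddfB; apply: vanish_deriv; rewrite fps_subst_mpoly //.
  exact: fps_subst_approx.
rewrite [fps_deriv j _](_ : _ = \sum_i fps_subst g (fps_mpoly p^`M(i))
                                         * fps_deriv j (g i)); last first.
  rewrite fps_subst_mpoly //; under eq_bigr do rewrite fps_subst_mpoly //.
  elim/mpoly_alg_ind: {vp}p => [c|i|p q Kp Kq|p q Kp Kq].
  - rewrite mmapC fps_derivC big1 // => i _.
    by rewrite mderivC rmorph0 mul0r.
  - rewrite mmapX mmap1U (bigD1 i) //= big1 => [|i' ne_i].
      by rewrite mderivXU eqxx rmorph1 mul1r addr0.
    by rewrite mderivXU (negbTE ne_i) rmorph0 mul0r.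
  - rewrite rmorphD raddfD /= Kp Kq -big_split; apply: eq_bigr => i _ /=.
    by rewrite mderivD rmorphD mulrDl.
  - rewrite rmorphM fps_derivM /= Kp Kq mulr_suml mulr_sumr -big_split.
    apply: eq_bigr => i _ /=.
    by rewrite mderivM rmorphD !rmorphM /= mulrDl; congr (_ + _);
      rewrite ?mulrA // mulrAC.
rewrite -sumrB; apply: vanish_sum => i _; rewrite -mulrBl; apply: vanishMl.
rewrite -fps_deriv_mpoly !(fps_subst_rmorphE vg) -rmorphB -raddfB.
by apply: vanish_subst => //; apply: vanish_deriv; apply: vanishC.
Qed.

(** * Fixed points and the inverse function theorem *)

(** The k-th iterate of 0 is correct up to order k + 1, so the coefficient of m
    in the fixed point is that of the iterate of rank [mdeg m]. *)
Lemma contraction_fixpoint (R : comNzRingType) n (I : Type)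
    (G : (I -> fps R n) -> I -> fps R n) :
    (forall f, (forall i, vanish 1 (f i)) -> forall i, vanish 1 (G f i)) ->
    (forall d f g, (forall i, vanish 1 (f i)) -> (forall i, vanish 1 (g i)) ->
      (forall i, vanish d.+1 (f i - g i)) ->
      forall i, vanish d.+2 (G f i - G g i)) ->
  exists2 f, forall i, vanish 1 (f i) & forall i, G f i = f i.
Proof.
move=> G1 Gd; pose u k := iter k G (fun _ => 0).
have u1 k i : vanish 1 (u k i).
  elim: k i => [|k IHk] i; first exact: vanish0.
  exact: G1.
have uS k i : vanish k.+1 (u k.+1 i - u k i).
  elim: k i => [|k IHk] i; first exact: vanishB.
  by apply: Gd IHk i => j.
have uD k l i : vanish k.+1 (u (k + l)%N i - u k i).
  elim: l => [|l IHl]; first by rewrite addn0 subrr; apply: vanish0.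
  rewrite addnS; apply: vanish_trans IHl.
  by apply: vanish_le (uS _ i); rewrite ltnS leq_addr.
pose f i : fps R n := fun m => u (mdeg m) i m.
have fu k i : vanish k.+1 (f i - u k i).
  move=> m; rewrite ltnS => lemk; rewrite -(subnKC lemk) fpsB /f.
  by rewrite -opprB; have := uD (mdeg m) (k - mdeg m)%N i m (ltnSn _);
    rewrite fpsB => ->; rewrite oppr0.
have f1 i : vanish 1 (f i).
  by rewrite -[f i](subrK (u 0%N i)); apply: vanishD.
exists f => // i; apply: vanish_eq => d.
apply: (@vanish_trans _ _ _ (u d.+1 i)).
  by apply: (@vanish_le _ _ _ d.+2); [rewrite ltnW | apply: Gd].
by apply: vanishC; apply: (@vanish_le _ _ _ d.+2); [rewrite ltnW|].
Qed.

(** Writing the inverse as 1 + h turns a (1 + h) = 1 into the fixed point equation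
    h = (1 - a) (1 + h). *)
Lemma fps_inverse (R : comNzRingType) n (a : fps R n) :
  a 0%MM = 1 -> exists b, a * b = 1.
Proof.
move=> a0; have va : vanish 1 (1 - a).
  by apply/vanish1P; rewrite fpsB a0 fps1_0 subrr.
have [|d f g _ _ vfg i|h _ hE] := @contraction_fixpoint R n unit
  (fun h _ => (1 - a) * (1 + h tt)).
- by move=> f _ _; apply: vanishMl.
- rewrite -mulrBr opprD addrACA subrr add0r -add1n.
  exact: vanishM (vfg tt).
exists (1 + h tt); have := hE tt; rewrite mulrBl mul1r /= => hE'.
by rewrite -[LHS](subKr (1 + h tt)) hE' addrK.
Qed.

Lemma fps_deriv0 (R : comNzRingType) n (i : 'I_n) (f : fps R n) :
  fps_deriv i f 0%MM = f U_(i)%MM.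
Proof. by rewrite /fps_deriv add0m mnm0E mulr1n. Qed.

Lemma vanish2P (R : comNzRingType) n (f : fps R n) :
  f 0%MM = 0 -> (forall i, fps_deriv i f 0%MM = 0) -> vanish 2 f.
Proof.
move=> f0 f1 m; rewrite ltnS leq_eqVlt ltnS leqn0 => /orP[/mdeg1P[i /eqP ->]|].
  by rewrite -fps_deriv0.
by rewrite mdeg_eq0 => /eqP ->.
Qed.

Definition jacobian0 (R : comNzRingType) n (psi : 'I_n -> fps R n) : 'M[R]_n :=
  \matrix_(i, j) fps_deriv j (psi i) 0%MM.

(** With J the Jacobian matrix at 0 and rem = psi - J x, of order at least 2, the
    equation psi(phi) = x is the fixed point equation
    phi = J^-1 (x - rem(phi)).  The Jacobian matrix of the solution is invertible
    by the chain rule at 0. *)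
Lemma fps_inverse_function (R : comUnitRingType) n (psi : 'I_n -> fps R n) :
    (forall i, psi i 0%MM = 0) -> jacobian0 psi \in unitmx ->
  exists phi : 'I_n -> fps R n,
    [/\ forall i, phi i 0%MM = 0, jacobian0 phi \in unitmx
      & forall i, fps_subst phi (psi i) = fps_var i].
Proof.
move=> psi0 Ju; set J := jacobian0 psi in Ju *.
pose K := invmx J.
pose lin j : fps R n := \sum_l fps_const (J j l) * fps_var l.
pose rem j := psi j - lin j.
have lin0 j : lin j 0%MM = 0.
  rewrite -/(constcoef _) raddf_sum big1 //= => l _.
  by rewrite rmorphM /= [X in _ * X]fps_var0 mulr0.
have vrem j : vanish 2 (rem j).
  apply: vanish2P => [|l]; first by rewrite /rem fpsB psi0 lin0 subrr.
  rewrite /rem raddfB /= fpsB raddf_sum /= fps_sumE.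
  rewrite (bigD1 l) //= big1 => [|l' ne_l].
    rewrite addr0 fps_derivM fps_derivC mul0r add0r fps_deriv_var eqxx mulr1.
    by rewrite fps_constE eqxx mxE subrr.
  by rewrite fps_derivM fps_derivC fps_deriv_var eq_sym (negbTE ne_l) mulr0
    mul0r addr0 fps0.
have [f vf|d f g vf vg vfg i|phi vphi phiE] := @contraction_fixpoint R n 'I_n
  (fun f i => \sum_j fps_const (K i j) * (fps_var j - fps_subst f (rem j))).
- move=> i; apply: vanish_sum => j _; apply: vanishMr; apply: vanishB.
    by apply/vanish1P; rewrite fps_var0.
  by apply: vanish_subst => //; apply: vanish_le (vrem j).
- rewrite -sumrB; apply: vanish_sum => j _; rewrite -mulrBr; apply: vanishMr.
  by rewrite opprB addrC addrA subrK; apply: fps_subst_contract => // l;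
    apply: vanishC.
have psiE j : fps_subst phi (psi j) = fps_var j.
  rewrite -[psi j](subrK (lin j)) -/(rem j) fps_substD // addrC.
  rewrite [X in X + _](_ : _ = fps_var j - fps_subst phi (rem j)) ?subrK //.
  rewrite (fps_subst_rmorphE vphi) raddf_sum /=.
  transitivity (\sum_l (\sum_i fps_const (J j i) * fps_const (K i l))
                  * (fps_var l - fps_subst phi (rem l))).
    under [RHS]eq_bigr do rewrite mulr_suml; rewrite exchange_big /=.
    apply: eq_bigr => i _; rewrite fps_substM // fps_substC // fps_subst_var //.
    by rewrite -{1}phiE mulr_sumr; apply: eq_bigr => l _; rewrite mulrA.
  have JK l : \sum_i fps_const (J j i) * fps_const (K i l)
                = (j == l)%:R :> fps R n.
    transitivity (fps_const ((J *m K) j l) : fps R n).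
      by rewrite mxE raddf_sum; apply: eq_bigr => i _; rewrite /= rmorphM.
    by rewrite mulmxV // mxE rmorph_nat.
  rewrite (bigD1 j) //= JK eqxx mul1r big1 ?addr0 // => l ne_l.
  by rewrite JK eq_sym (negbTE ne_l) mul0r.
exists phi; split=> // [i|]; first exact/vanish1P.
suff /mulmx1_unit[] : J *m jacobian0 phi = 1%:M by [].
apply/matrixP => i j; rewrite !mxE.
have := congr1 (fun f => constcoef (fps_deriv j f)) (psiE i).
rewrite /= fps_deriv_subst // fps_deriv_var rmorph_nat eq_sym => <-.
rewrite raddf_sum /=; apply: eq_bigr => l _.
by rewrite !mxE rmorphM /= [constcoef (fps_subst _ _)]fps_subst0.
Qed.

(** An infinite sum whose k-th term has order at least k is, up to order d, the sum
    of its first d terms.  Linear operations on infinite sums thereby reduce to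
    finite ones. *)
Lemma fps_sum_approx (R : comNzRingType) n (F : nat -> fps R n) d :
  (forall k, vanish k (F k)) -> vanish d (fps_sum F - \sum_(k < d) F k).
Proof.
move=> vF m ltm; rewrite fpsB fps_sumE /fps_sum.
rewrite (big_ord_widen d (fun i => F i m) ltm) big_mkcond /= -sumrB.
apply: big1 => i _; rewrite ltnS; case: leqP => [_|lt_mi]; first exact: subrr.
by rewrite vF // subrr.
Qed.

Lemma fps_subst_sum (R : comNzRingType) n k (g : 'I_n -> fps R k)
    (F : nat -> fps R n) :
    (forall i, vanish 1 (g i)) -> (forall i, vanish i (F i)) ->
  fps_subst g (fps_sum F) = fps_sum (fun i => fps_subst g (F i)).
Proof.
move=> vg vF; have vgF i : vanish i (fps_subst g (F i)) by apply: vanish_subst.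
apply: vanish_eq => d.
apply: vanish_trans (vanishC (fps_sum_approx (d := d) vgF)).
rewrite (fps_subst_rmorphE vg) -raddf_sum -raddfB.
by apply: vanish_subst => //; apply: fps_sum_approx.
Qed.

Lemma fps_mul_sum (R : comNzRingType) n (f : fps R n) (F : nat -> fps R n) :
    (forall i, vanish i (F i)) ->
  f * fps_sum F = fps_sum (fun i => f * F i).
Proof.
move=> vF; have vfF i : vanish i (f * F i) by apply: vanishMr.
apply: vanish_eq => d.
apply: vanish_trans (vanishC (fps_sum_approx (d := d) vfF)).
rewrite -mulr_sumr -mulrBr; apply: vanishMr; exact: fps_sum_approx.
Qed.

(** * Completion of independent rows *)

(** Gaussian elimination writes D as L (1 0) U, and the block diagonal matrix of
    L and 1 times U is an invertible matrix that begins with the rows of D. *)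
Lemma row_free_complete (F : fieldType) q p (D : 'M[F]_(q, p)) : row_free D ->
  exists2 M : 'M[F]_p, M \in unitmx &
    forall (i : 'I_q) (i' j : 'I_p), i' = i :> nat -> M i' j = D i j.
Proof.
move=> freeD; have leqp : (q <= p)%N by rewrite -(eqP freeD) rank_leq_col.
have [k def_p] : exists k, p = (q + k)%N by exists (p - q)%N; rewrite subnKC.
subst p; exists (block_mx (col_ebase D) 0 0 1%:M *m row_ebase D).
  rewrite unitmx_mul row_ebase_unit andbT unitmxE det_ublock det1 mulr1.
  by rewrite -unitmxE col_ebase_unit.
move=> i i' j eq_i; have -> : i' = lshift k i by apply/val_inj.
have := mulmx_ebase D; rewrite (eqP freeD) pid_mx_row mul_mx_row mulmx1 mulmx0.
by move/matrixP/(_ i j) => <-; rewrite /block_mx mul_col_mx col_mxEu.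
Qed.

(** * Planar vector fields *)

Section VF.
Context {R : realType} {p : nat}.
Implicit Types (f g : fps R (2 + p)) (c : fps R p) (u w : vfield R p).
Notation x := (@xvar R p).
Notation y := (@yvar R p).

Lemma vf_eqP u w : u 0 0 = w 0 0 -> u 1 0 = w 1 0 -> u = w.
Proof.
move=> e0 e1; apply/matrixP => i j; rewrite (ord1 j).
by case: i => [[|[|//]] lti]; [rewrite (_ : Ordinal _ = 0)|rewrite (_ : Ordinal _ = 1)];
  try exact: val_inj.
Qed.

Lemma vfE0 f g j : vf f g 0 j = f. Proof. by rewrite mxE. Qed.
Lemma vfE1 f g j : vf f g 1 j = g. Proof. by rewrite mxE. Qed.

Lemma vfD f g f' g' : vf f g + vf f' g' = vf (f + f') (g + g').
Proof. by apply: vf_eqP; rewrite mxE !(vfE0, vfE1). Qed.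

Lemma vfZ h f g : h *: vf f g = vf (h * f) (h * g).
Proof. by apply: vf_eqP; rewrite mxE !(vfE0, vfE1). Qed.

Lemma vf_sum (I : Type) (r : seq I) (P : pred I) (F G : I -> fps R (2 + p)) :
  \sum_(i <- r | P i) vf (F i) (G i)
    = vf (\sum_(i <- r | P i) F i) (\sum_(i <- r | P i) G i).
Proof.
apply: vf_eqP; rewrite summxE !(vfE0, vfE1);
  by apply: eq_bigr => i _; rewrite !(vfE0, vfE1).
Qed.

Lemma cst1 : cst 1 = 1 :> fps R (2 + p).
Proof. exact: rmorph1. Qed.
Lemma cst0 : cst 0 = 0 :> fps R (2 + p).
Proof. exact: rmorph0. Qed.

(** Indexed by k = j + 1, the exponent of y in A^(-1)_j, to include j = -1. *)
Lemma fA_shear k : fA (-1) (k%:Z - 1) = vf (y ^+ k) 0 :> vfield R p.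
Proof.
have e1 : k%:Z - 1 - -1 = k by rewrite opprK subrK.
have e2 : k%:Z - 1 + 2 = k%:Z + 1 by rewrite -addrA.
rewrite /fA e1 e2 addNr mul0r cst0 !mul0r oppr0 expr0 mulr1 divff.
  by rewrite cst1 mul1r.
by rewrite intr_eq0 -PoszD addn1.
Qed.

Lemma fA_rotation : fA 1 0 = vf 0 (- x) :> vfield R p.
Proof.
have e1 : (0 : int) - 1 + 1 = 0 by [].
have e2 : (1 : int) + 1 = 2 by [].
rewrite /fA e1 e2 add0r mul0r cst0 !mul0r divff ?cst1 ?mul1r ?expr1 ?mulr1 //.
by rewrite pnatr_eq0.
Qed.

Lemma fB_radial k : fB 0 k%:Z = vf (x * y ^+ k) (y ^+ k.+1) :> vfield R p.
Proof.
rewrite /fB add0r !subr0 expr0 mul1r expr1.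
by rewrite -PoszD addn1.
Qed.
End VF.

(** * Changes of variables and parameters *)

Section Transformations.
Context {R : realType} {p : nat}.
Implicit Types (f g : fps R (2 + p)) (c : fps R p) (u w : vfield R p).
Implicit Types (phi : 'I_p -> fps R p) (Phi L : 'cV[fps R (2 + p)]_2).
Notation x := (@xvar R p).
Notation y := (@yvar R p).

Lemma fA_shear_nat k : fA (-1) k%:Z = vf (y ^+ k.+1) 0 :> vfield R p.
Proof. by rewrite (_ : k%:Z = k.+1%:Z - 1) ?fA_shear // -addn1 PoszD addrK. Qed.

Lemma mu_vars_vanish (i : 'I_p) : vanish 1 (fps_var (rshift 2 i) : fps R (2 + p)).
Proof. by apply/vanish1P; rewrite fps_var0. Qed.

Lemma par_is_nmod_morphism : nmod_morphism (@par R p).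
Proof. exact: (fps_subst_is_nmod_morphism mu_vars_vanish). Qed.
Lemma par_is_monoid_morphism : monoid_morphism (@par R p).
Proof. exact: (fps_subst_is_monoid_morphism mu_vars_vanish). Qed.
HB.instance Definition _ := GRing.isNmodMorphism.Build (fps R p) (fps R (2 + p))
  (@par R p) par_is_nmod_morphism.
HB.instance Definition _ := GRing.isMonoidMorphism.Build (fps R p) (fps R (2 + p))
  (@par R p) par_is_monoid_morphism.

Lemma par_const (r : R) : par (fps_const r) = cst r :> fps R (2 + p).
Proof. exact: (fps_substC mu_vars_vanish). Qed.

Lemma par_var (i : 'I_p) : par (fps_var i) = fps_var (rshift 2 i) :> fps R (2 + p).
Proof. exact: (fps_subst_var mu_vars_vanish). Qed.

Lemma par0 c : par c 0%MM = c 0%MM.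
Proof. exact: (fps_subst0 mu_vars_vanish). Qed.

Lemma fps_deriv_par_state (j : 'I_2) c : fps_deriv (lshift p j) (par c) = 0.
Proof.
rewrite /par (fps_deriv_subst _ _ mu_vars_vanish) big1 // => i _.
by rewrite fps_deriv_var eq_lrshift mulr0.
Qed.

Lemma fps_deriv_par (j : 'I_p) c :
  fps_deriv (rshift 2 j) (par c) = par (fps_deriv j c).
Proof.
rewrite /par (fps_deriv_subst _ _ mu_vars_vanish) (bigD1 j) //= big1 => [|i ne_ij].
  by rewrite fps_deriv_var eqxx mulr1 addr0.
by rewrite fps_deriv_var eq_rshift eq_sym (negbTE ne_ij) mulr0.
Qed.

(** The substitution performed by [pull], as a named family. *)
Definition subst_values phi Phi (i : 'I_(2 + p)) : fps R (2 + p) :=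
  match split i with inl j => Phi j 0 | inr j => par (phi j) end.

Lemma subst_values_state phi Phi j : subst_values phi Phi (lshift p j) = Phi j 0.
Proof. by rewrite /subst_values (unsplitK (inl j)). Qed.

Lemma subst_values_par phi Phi j : subst_values phi Phi (rshift 2 j) = par (phi j).
Proof. by rewrite /subst_values (unsplitK (inr j)). Qed.

Lemma subst_values_vanish phi Phi :
    (forall i, phi i 0%MM = 0) -> (forall i, Phi i 0 0%MM = 0) ->
  forall i, vanish 1 (subst_values phi Phi i).
Proof.
move=> phi0 Phi0 i; apply/vanish1P; rewrite /subst_values.
by case: (split i) => j //; rewrite par0.
Qed.

Lemma transformsP phi Phi (T : fps R (2 + p)) w u :
  transforms phi Phi T w u <->
  forall i, \sum_k fps_deriv (lshift p k) (Phi i 0) * u k 0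
              = T * fps_subst (subst_values phi Phi) (w i 0).
Proof.
have LE i : (state_jacobian Phi *m u) i 0
    = \sum_k fps_deriv (lshift p k) (Phi i 0) * u k 0.
  by rewrite mxE; apply: eq_bigr => k _; rewrite mxE.
split=> [/matrixP tw i|tw]; first by rewrite -LE tw !mxE.
by apply/matrixP => i j; rewrite (ord1 j) LE tw !mxE.
Qed.

Section Assign.
Variables (phi : 'I_p -> fps R p) (L : 'cV[fps R (2 + p)]_2).
Hypotheses (phi0 : forall i, phi i 0%MM = 0) (L0 : forall i, L i 0 0%MM = 0).
Let vs := subst_values_vanish phi0 L0.

Lemma subst_par c :
  fps_subst (subst_values phi L) (par c) = par (fps_subst phi c).
Proof.
have vphi i : vanish 1 (phi i) by apply/vanish1P.
rewrite /par (fps_subst_comp _ mu_vars_vanish vs).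
rewrite (fps_subst_comp _ vphi mu_vars_vanish).
apply: fps_subst_eq => i.
by rewrite fps_subst_var // subst_values_par.
Qed.

Lemma subst_values_comp Phi f : (forall i, Phi i 0 0%MM = 0) ->
  fps_subst (subst_values phi L) (fps_subst (subst_values fps_var Phi) f)
    = fps_subst (subst_values phi (pull phi L Phi)) f.
Proof.
move=> Phi0; have var0 (k : 'I_p) : fps_var k 0%MM = 0 :> R by exact: fps_var0.
rewrite (fps_subst_comp _ (subst_values_vanish var0 Phi0) vs).
apply: fps_subst_eq => k; rewrite -[k]splitK; case: (split k) => l /=.
  by rewrite !subst_values_state mxE.
by rewrite !subst_values_par par_var fps_subst_var // subst_values_par.
Qed.

Lemma state_jacobian_pull Phi :
  state_jacobian (pull phi L Phi)
    = map_mx (fps_subst (subst_values phi L)) (state_jacobian Phi)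
        *m state_jacobian L.
Proof.
apply/matrixP => i j; rewrite !mxE (fps_deriv_subst _ _ vs) big_split_ord /=.
rewrite [X in _ + X]big1 ?addr0 => [|l _]; last first.
  by rewrite subst_values_par fps_deriv_par_state mulr0.
by apply: eq_bigr => l _; rewrite !mxE subst_values_state.
Qed.

(** The change of variables L may depend on the new parameters phi introduces: as
    phi(nu) does not involve the state variables, the chain rule for the
    composite has no contribution from it. *)
Lemma transforms_comp Phi (T T' : fps R (2 + p)) w w' u :
    (forall i, Phi i 0 0%MM = 0) ->
    transforms fps_var Phi T w w' -> transforms phi L T' w' u ->
  transforms phi (pull phi L Phi) (fps_subst (subst_values phi L) T * T') w u.
Proof.
move=> Phi0 /transformsP tw /transformsP tu; apply/transformsP => i.
transitivity (\sum_l fps_subst (subst_values phi L)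
    (fps_deriv (lshift p l) (Phi i 0)) * (T' * fps_subst (subst_values phi L) (w' l 0))).
  have JE k : fps_deriv (lshift p k) (pull phi L Phi i 0)
      = \sum_l fps_subst (subst_values phi L) (fps_deriv (lshift p l) (Phi i 0))
                * fps_deriv (lshift p k) (L l 0).
    have /matrixP/(_ i k) := state_jacobian_pull Phi.
    by rewrite !mxE => ->; apply: eq_bigr => l _; rewrite !mxE.
  under eq_bigr do rewrite JE mulr_suml; rewrite exchange_big /=.
  apply: eq_bigr => l _; rewrite -tu mulr_sumr.
  by apply: eq_bigr => k _; rewrite mulrA.
rewrite -(subst_values_comp (w i 0) Phi0).
rewrite mulrAC -(fps_substM vs) -tw (fps_subst_rmorphE vs) raddf_sum mulr_suml.
by apply: eq_bigr => l _; rewrite /= (fps_substM vs) mulrAC mulrA.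
Qed.

Lemma state_change_comp Phi :
  state_change Phi -> state_change L -> state_change (pull phi L Phi).
Proof.
have cE (M : 'cV[fps R (2 + p)]_2) :
    (\matrix_(i, j) state_jacobian M i j 0%MM)
      = map_mx (constcoef : fps R (2 + p) -> R) (state_jacobian M).
  by apply/matrixP => i j; rewrite !mxE.
rewrite /state_change !cE => -[Phi0 dPhi] [_ dL]; split=> [i|].
  by rewrite mxE fps_subst0.
rewrite state_jacobian_pull map_mxM det_mulmx mulf_neq0 //.
rewrite -map_mx_comp (_ : map_mx _ _ = map_mx constcoef (state_jacobian Phi)) //.
by apply/matrixP => i j; rewrite !mxE /= [LHS]fps_subst0.
Qed.
End Assign.

Section Scaling.
Variables (phi : 'I_p -> fps R p) (q : fps R p).
Hypotheses (phi0 : forall i, phi i 0%MM = 0) (q0 : q 0%MM = 1).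

(** The change of variable x = q X, for a series q in the new parameters. *)
Definition xscaling : 'cV[fps R (2 + p)]_2 := vf (par q * x) y.

Lemma xscaling0 i : xscaling i 0 0%MM = 0.
Proof.
rewrite mxE; case: ifP => _; last exact: fps_var0.
by rewrite fpsM0 [X in _ * X]fps_var0 mulr0.
Qed.

Lemma xscaling_jacobian :
  state_jacobian xscaling
    = \matrix_(i, j) ((if i == ord0 then par q else 1) *+ (i == j)).
Proof.
apply/matrixP => i j; rewrite !mxE.
case: ifP => [/eqP ->|ne_i].
  rewrite fps_derivM fps_deriv_par_state mul0r add0r fps_deriv_var.
  by rewrite eq_lshift eq_sym; case: eqP; rewrite ?mulr1 ?mulr0.
rewrite fps_deriv_var eq_lshift eq_sym (_ : i = ord_max) //.
by apply/val_inj; case: i ne_i => [[|[|]]].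
Qed.

Lemma xscaling_state_change : state_change xscaling.
Proof.
split; first exact: xscaling0.
rewrite (_ : \matrix_(i, j) _ = 1%:M) ?det1 ?oner_neq0 //.
apply/matrixP => i j; rewrite xscaling_jacobian !mxE.
case: (i == j); rewrite ?mulr1n ?mulr0n ?fps0 //.
by case: ifP; rewrite ?par0 // fps1_0.
Qed.

Let vs := subst_values_vanish phi0 xscaling0.

Lemma transforms_xscaling f g f' g' :
    par q * f' = fps_subst (subst_values phi xscaling) f ->
    g' = fps_subst (subst_values phi xscaling) g ->
  transforms phi xscaling 1 (vf f g) (vf f' g').
Proof.
move=> eqf eqg; apply/transformsP => i; rewrite mul1r.
have JE k : fps_deriv (lshift p k) (xscaling i 0)
    = (if i == ord0 then par q else 1) *+ (i == k).
  by have /matrixP/(_ i k) := xscaling_jacobian; rewrite !mxE.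
under eq_bigr do rewrite JE; rewrite (bigD1 i) //= big1 ?addr0 => [|k ne_k].
  rewrite eqxx mulr1n !mxE; case: ifP => _; first by rewrite eqf.
  by rewrite mul1r eqg.
by rewrite [i == k]eq_sym (negbTE ne_k) mulr0n mul0r.
Qed.

Lemma xscaling_subst_x : fps_subst (subst_values phi xscaling) x = par q * x.
Proof. by rewrite fps_subst_var // subst_values_state vfE0. Qed.
Lemma xscaling_subst_y : fps_subst (subst_values phi xscaling) y = y.
Proof. by rewrite fps_subst_var // subst_values_state mxE. Qed.
End Scaling.
End Transformations.

(** * Derivative with respect to the parameters *)

Lemma fps_subst_zero (R : comNzRingType) n k (f : fps R n) :
  fps_subst (fun _ => 0 : fps R k) f = fps_const (f 0%MM).
Proof.
have v0 (i : 'I_n) : vanish 1 (0 : fps R k) by exact: vanish0.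
apply: vanish_eq => d; apply: (@vanish_le _ _ _ d.+1) => //.
have := fps_subst_approx v0 (vanish_trunc d.+1 f).
rewrite (_ : mmap _ _ _ = fps_const (f 0%MM)) //.
transitivity (fps_const (fps_trunc d.+1 f)@_0 : fps R k); last first.
  by rewrite fps_truncE mdeg0.
elim/mpoly_alg_ind: (fps_trunc d.+1 f) => [c|i|a b Ka Kb|a b Ka Kb].
- by rewrite mmapC mcoeffC eqxx mulr1.
- by rewrite mmapX mmap1U -[_@__]/(fps_var i 0%MM) fps_var0 rmorph0.
- by rewrite mmapD Ka Kb mcoeffD rmorphD.
rewrite rmorphM /= Ka Kb -rmorphM /=; congr fps_const.
by rewrite -[RHS]/(fps_mpoly (a * b) 0%MM) rmorphM fpsM0.
Qed.

Section ParameterDerivative.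
Context {R : realType} {p : nat}.
Implicit Types (f g : fps R (2 + p)) (c : fps R p) (w : vfield R p).
Notation x := (@xvar R p).
Notation y := (@yvar R p).

(** The values (x, y, 0) that [at_mu0] substitutes. *)
Definition subst_mu0 (i : 'I_(2 + p)) : fps R 2 :=
  match split i with inl j => fps_var j | inr _ => 0 end.

Lemma subst_mu0_vanish i : vanish 1 (subst_mu0 i).
Proof.
rewrite /subst_mu0; case: (split i) => j; last exact: vanish0.
by apply/vanish1P; rewrite fps_var0.
Qed.

Lemma subst_mu0_par c : fps_subst subst_mu0 (par c) = fps_const (c 0%MM).
Proof.
rewrite /par fps_subst_comp; [|exact: mu_vars_vanish|exact: subst_mu0_vanish].
rewrite -(fps_subst_zero 2 c); apply: fps_subst_eq => i.
by rewrite (fps_subst_var subst_mu0_vanish) /subst_mu0 (unsplitK (inr i)).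
Qed.

Variable v : 'rV[R]_p.

Definition dirderiv0 c : R := \sum_i v 0 i * fps_deriv i c 0%MM.

Definition dmu0_fps f : fps R 2 :=
  \sum_(i < p) fps_const (v 0 i) * fps_subst subst_mu0 (fps_deriv (rshift 2 i) f).

(** Stationary series are closed under the ring operations, so that a vector field
    is stationary as soon as its coefficients are: this avoids computing the
    derivative of the normal form. *)
Definition stationary f := dmu0_fps f = 0.

Lemma dmu0E w i j : dmu0 w v i j = dmu0_fps (w i j).
Proof. by rewrite /dmu0 summxE; apply: eq_bigr => l _; rewrite !mxE. Qed.

Lemma stationaryD f g : stationary f -> stationary g -> stationary (f + g).
Proof.
rewrite /stationary => ff fg; transitivity (dmu0_fps f + dmu0_fps g).
  rewrite /dmu0_fps -big_split; apply: eq_bigr => i _.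
  by rewrite raddfD /= (fps_substD subst_mu0_vanish) mulrDr.
by rewrite ff fg addr0.
Qed.

Lemma stationaryM f g : stationary f -> stationary g -> stationary (f * g).
Proof.
rewrite /stationary => ff fg.
transitivity (dmu0_fps f * fps_subst subst_mu0 g + fps_subst subst_mu0 f * dmu0_fps g).
  rewrite /dmu0_fps mulr_suml mulr_sumr -big_split.
  apply: eq_bigr => i _ /=.
  rewrite fps_derivM (fps_substD subst_mu0_vanish) !(fps_substM subst_mu0_vanish) mulrDr.
  by rewrite mulrA; congr (_ + _); rewrite mulrCA.
by rewrite ff fg mul0r mulr0 addr0.
Qed.

Lemma stationary_par c : dirderiv0 c = 0 -> stationary (par c).
Proof.
move=> dc; rewrite /stationary.
transitivity (fps_const (dirderiv0 c) : fps R 2); last by rewrite dc rmorph0.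
rewrite /dmu0_fps /dirderiv0 raddf_sum.
by apply: eq_bigr => i _; rewrite fps_deriv_par subst_mu0_par /= rmorphM.
Qed.

Lemma stationary_cst r : stationary (cst r).
Proof.
rewrite -par_const; apply: stationary_par; rewrite /dirderiv0 big1 // => i _.
by rewrite fps_derivC fps0 mulr0.
Qed.

Lemma stationary0 : stationary 0. Proof. by rewrite -cst0; apply: stationary_cst. Qed.

Lemma stationary_sum (I : Type) (r : seq I) (P : pred I) (F : I -> fps R (2 + p)) :
  (forall i, P i -> stationary (F i)) -> stationary (\sum_(i <- r | P i) F i).
Proof. by move=> fF; apply: (big_ind stationary stationary0 stationaryD). Qed.

Lemma stationary_state (j : 'I_2) : stationary (fps_var (lshift p j)).
Proof.
rewrite /stationary /dmu0_fps big1 // => i _.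
by rewrite fps_deriv_var eq_rlshift -[false%:R](rmorph0 (@fps_const R (2 + p)))
    (fps_substC subst_mu0_vanish) rmorph0 mulr0.
Qed.

Lemma stationaryX f k : stationary f -> stationary (f ^+ k).
Proof.
move=> ff; elim: k => [|k IHk]; first by rewrite expr0 -cst1; apply: stationary_cst.
by rewrite exprS; apply: stationaryM.
Qed.

(** The factor a in the new parameters does not affect their differentials. *)
Lemma dirderiv0M (a c : fps R p) : a 0%MM = 1 -> dirderiv0 a = 0 ->
  dirderiv0 (a * c) = dirderiv0 c.
Proof.
move=> a0 da; transitivity (dirderiv0 a * c 0%MM + a 0%MM * dirderiv0 c).
  rewrite /dirderiv0 mulr_suml mulr_sumr -big_split.
  apply: eq_bigr => i _ /=.
  rewrite fps_derivM fpsD !fpsM0 mulrDr.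
  by congr (_ + _); [rewrite mulrA|rewrite mulrCA].
by rewrite da a0 mul0r mul1r add0r.
Qed.

Lemma dirderiv0D c c' : dirderiv0 (c + c') = dirderiv0 c + dirderiv0 c'.
Proof.
rewrite /dirderiv0 -big_split; apply: eq_bigr => i _ /=.
by rewrite raddfD /= fpsD mulrDr.
Qed.

Lemma dirderiv0_const r : dirderiv0 (fps_const r) = 0.
Proof. by rewrite /dirderiv0 big1 // => i _; rewrite fps_derivC fps0 mulr0. Qed.
End ParameterDerivative.

(** The derivative is a linear function of v that vanishes on the kernel of D, hence
    factors through D.  Independent vectors in its image come from directions,
    the rows of V, whose images under D are independent. *)
Lemma has_rank_row_free (R : realType) p (w : vfield R p) q
    (D : 'M[R]_(q, p)) :
    (forall v : 'rV_p, D *m v^T = 0 -> dmu0 w v = 0) ->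
  has_rank (dmu0 w) q -> row_free D.
Proof.
move=> DL [e [eL free_e _]]; have [v ev] := choice eL.
pose V : 'M[R]_(q, p) := \matrix_i v i.
have DV : row_free (V *m D^T).
  apply: inj_row_free => c cVD.
  have : dmu0 w (c *m V) = 0.
    by apply: DL; rewrite trmx_mul -[D]trmxK -trmx_mul -trmx_mul -mulmxA cVD trmx0.
  move=> L0; apply/rowP => i; rewrite [RHS]mxE.
  apply: (free_e (fun i => c 0 i)); transitivity (dmu0 w (c *m V)); last by [].
  rewrite [RHS]/dmu0.
  under [LHS]eq_bigr do rewrite ev /dmu0 scaler_sumr.
  rewrite exchange_big; apply: eq_bigr => l _ /=.
  under eq_bigr do rewrite scalerA -rmorphM.
  rewrite -scaler_suml mxE rmorph_sum; congr (_ *: _).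
  by apply: eq_bigr => k _; rewrite mxE.
rewrite /row_free eqn_leq rank_leq_row -mxrank_tr /=.
by apply: leq_trans (mxrankM_maxr V D^T); rewrite (eqP DV).
Qed.

(** The parameters beyond the q-th one are linear forms that complete the
    differentials of the psi_k to a basis. *)
Lemma reparametrization_exists (R : realType) p q (psi : nat -> fps R p) :
    (forall k, (k < q)%N -> psi k 0%MM = 0) ->
    row_free (\matrix_(k < q, j < p) fps_deriv j (psi k) 0%MM) ->
  exists phi, reparametrization phi /\
    forall k, (k < q)%N -> par (fps_subst phi (psi k)) = mu k.+1.
Proof.
move=> psi0 freeD; have leqp : (q <= p)%N by rewrite -(eqP freeD) rank_leq_col.
have [M Mu defM] := row_free_complete freeD.
pose lin (i : 'I_p) : fps R p := \sum_j fps_const (M i j) * fps_var j.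
pose psi' (i : 'I_p) := if (i < q)%N then psi i else lin i.
have [i||phi [phi0 phiu phiE]] := @fps_inverse_function R p psi'.
- rewrite /psi'; case: ifP => [/psi0 //|_]; rewrite /lin fps_sumE big1 // => j _.
  by rewrite fpsM0 fps_var0 mulr0.
- suff -> : jacobian0 psi' = M by [].
  apply/matrixP => i j; rewrite mxE /psi'; case: ifP => [lt_iq|_].
    by rewrite (defM (Ordinal lt_iq)) // mxE.
  rewrite /lin raddf_sum /= fps_sumE (bigD1 j) //= big1 => [|l ne_lj].
    rewrite addr0 fps_derivM fps_derivC mul0r add0r fps_deriv_var eqxx mulr1.
    by rewrite fps_constE eqxx.
  by rewrite fps_derivM fps_derivC fps_deriv_var eq_sym (negbTE ne_lj) mulr0
    mul0r addr0 fps0.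
exists phi; split=> [|k lt_kq]; first by split; rewrite // -unitfE -unitmxE.
have lt_kp := leq_trans lt_kq leqp.
have := phiE (Ordinal lt_kp); rewrite /psi' /= lt_kq => ->.
by rewrite par_var /mu insubT.
Qed.

Lemma sum_support (V : nmodType) n (r : seq nat) (H : nat -> V) :
    uniq r -> {in r, forall e, (e < n)%N} ->
    (forall e, (e < n)%N -> e \notin r -> H e = 0) ->
  \sum_(i < n) H i = \sum_(e <- r) H e.
Proof.
move=> Ur ltr H0; rewrite -(big_mkord xpredT H) /index_iota subn0.
rewrite (bigID (mem r)) /= [X in _ + X]big_seq_cond [X in _ + X]big1 ?addr0; last first.
  by move=> e; rewrite mem_iota add0n => /andP[/H0 H0e /H0e].
rewrite -big_filter; apply: perm_big; apply: uniq_perm => // [|e].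
  by rewrite filter_uniq ?iota_uniq.
by rewrite mem_filter mem_iota add0n; case: (boolP (e \in r)) => // /ltr ->.
Qed.

(** * Hamiltonian and Eulerian fields *)

Section Hamiltonian.
Context {R : realType} {p : nat}.
Implicit Types (f g h : fps R (2 + p)) (u : vfield R p).
Notation x := (@xvar R p).
Notation y := (@yvar R p).

Lemma hamiltonianD u1 u2 :
  hamiltonian u1 -> hamiltonian u2 -> hamiltonian (u1 + u2).
Proof.
move=> [H1 ->] [H2 ->]; exists (H1 + H2).
by rewrite vfD !raddfD.
Qed.

Definition state_independent h := forall j : 'I_2, fps_deriv (lshift p j) h = 0.

Lemma state_independentD h1 h2 :
  state_independent h1 -> state_independent h2 -> state_independent (h1 + h2).
Proof. by move=> s1 s2 j; rewrite raddfD /= s1 s2 addr0. Qed.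

Lemma state_independent_cst r : state_independent (cst r).
Proof. by move=> j; apply: fps_derivC. Qed.

Lemma state_independent_mu i : state_independent (mu i).
Proof.
rewrite /mu; case: insub => [k|] j; last by rewrite raddf0.
by rewrite -par_var fps_deriv_par_state.
Qed.

Lemma fps_derivXn (i : 'I_(2 + p)) f k :
  fps_deriv i (f ^+ k.+1) = (f ^+ k * fps_deriv i f) *+ k.+1.
Proof.
elim: k => [|k IHk]; first by rewrite expr1 expr0 mul1r.
rewrite exprS fps_derivM IHk mulrnAr mulrA -exprS [_ * f ^+ _]mulrC.
by rewrite [RHS]mulrS.
Qed.

Lemma cst_inv_nat k : cst k.+1%:R^-1 * k.+1%:R = 1 :> fps R (2 + p).
Proof.
by rewrite -(rmorph_nat (@fps_const R (2 + p))) -rmorphM /= mulVf ?pnatr_eq0 //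
  rmorph1.
Qed.

(** The Hamiltonian is h y^(k+1) / (k+1). *)
Lemma hamiltonian_shear h k :
  state_independent h -> hamiltonian (h *: vf (y ^+ k) 0).
Proof.
move=> hs; exists (h * cst (k.+1%:R^-1) * y ^+ k.+1); rewrite vfZ mulr0.
have dE (j : 'I_2) : fps_deriv (lshift p j) (h * cst (k.+1%:R^-1) * y ^+ k.+1)
    = h * y ^+ k * (j == ord_max)%:R.
  rewrite fps_derivM fps_derivXn fps_derivM hs state_independent_cst.
  rewrite mul0r mulr0 addr0 mul0r add0r fps_deriv_var eq_lshift.
  rewrite -[_ * _ *+ _]mulr_natl mulrA.
  by rewrite -[h * _ * _]mulrA cst_inv_nat mulr1 mulrA.
by rewrite !dE /= mulr1 mulr0 oppr0.
Qed.

(** The Hamiltonian is x^2 / 2. *)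
Lemma hamiltonian_rotation : hamiltonian (vf 0 (- x)).
Proof.
exists (cst (2%:R^-1) * x ^+ 2).
have dE (j : 'I_2) : fps_deriv (lshift p j) (cst (2%:R^-1) * x ^+ 2)
    = x * (j == ord0)%:R.
  rewrite fps_derivM fps_derivXn state_independent_cst mul0r add0r fps_deriv_var.
  by rewrite eq_lshift expr1 -[_ * _ *+ _]mulr_natl mulrA cst_inv_nat mul1r.
by rewrite !dE /= mulr1 mulr0.
Qed.
End Hamiltonian.

Section NormalForm.
Context {R : realType} {p : nat}.
Notation x := (@xvar R p).
Notation y := (@yvar R p).

Lemma target_systemE s js (alpha : nat -> R) :
  target_system s js alpha
    = hamiltonian_part s js alpha + eulerian_part s :> vfield R p.
Proof.
rewrite /target_system /hamiltonian_part /eulerian_part.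
rewrite fA_rotation (@fA_shear R p 0) (fA_shear_nat 0) (fB_radial s).
under [\sum_(1 <= i < _) _ *: fA _ _]eq_bigr do rewrite fA_shear_nat vfZ mulr0.
under [\sum_(k < _) _ *: fB _ _]eq_bigr do rewrite fB_radial vfZ.
rewrite !vf_sum !vfZ !vfD expr0 expr1 !mulr0 mulr1 !addr0 add0r big1_eq addr0.
by rewrite !addrA.
Qed.

Lemma hamiltonian_hamiltonian_part s js (alpha : nat -> R) :
  hamiltonian (hamiltonian_part s js alpha : vfield R p).
Proof.
apply: hamiltonianD; last first.
  apply: (big_ind hamiltonian) => [|u1 u2|i _]; last first.
  - rewrite fA_shear_nat; apply: hamiltonian_shear.
    apply: state_independentD; [exact: state_independent_cst|].
    exact: state_independent_mu.
  - exact: hamiltonianD.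
  - exists 0; by rewrite !raddf0; apply: vf_eqP; rewrite !mxE.
apply: hamiltonianD.
  apply: hamiltonianD; first by rewrite fA_rotation; exact: hamiltonian_rotation.
  rewrite (@fA_shear R p 0); apply: hamiltonian_shear; exact: state_independent_mu.
by rewrite (fA_shear_nat 0); apply: hamiltonian_shear; exact: state_independent_mu.
Qed.

(** The factor is y^s + sum_k mu_(k+1) y^k. *)
Lemma eulerian_eulerian_part s : eulerian (eulerian_part s : vfield R p).
Proof.
exists (y ^+ s + \sum_(k < s.-1) mu k.+1 * y ^+ k).
rewrite /eulerian_part fB_radial; under eq_bigr do rewrite fB_radial vfZ.
rewrite vf_sum vfD !mulrDl !mulr_suml [x * _]mulrC -exprSr.
congr (vf (_ + _) (_ + _)); apply: eq_bigr => k _.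
  by rewrite mulrAC mulrA.
by rewrite exprSr mulrA.
Qed.
End NormalForm.

(** * Coefficients of the normal form *)

(** The exponents j + 1 of y in the shears A^(-1)_j that survive: j = -1, j = 0
    and the j_i.  Listed in this order, the l-th one (from l = 0) gets
    the new parameter mu_(s + l). *)
Definition shear_exponents (js : seq nat) : seq nat :=
  [:: 0%N, 1%N & map S js].

Lemma jseq_uniq s r1 r2 N : uniq (jseq s r1 r2 N).
Proof. by rewrite /jseq; case: ifP => _; rewrite filter_uniq ?iota_uniq. Qed.

Lemma jseq_range s r1 r2 N j : j \in jseq s r1 r2 N -> (0 < j < N)%N.
Proof.
rewrite /jseq; case: ifP => _; rewrite mem_filter mem_iota => /andP[_]; lia.
Qed.

Section NormalFormCoefficients.
Context {R : realType} {p : nat}.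
Variables (s r1 r2 N : nat) (a : fps R p) (b : nat -> fps R p) (alpha : R)
  (aj : int -> fps R p) (c : nat -> fps R p).
Hypotheses (s_gt0 : (0 < s)%N) (hr1 : (2 * s < r1)%N) (hN : (r1 < N)%N).
Hypothesis nfc : nf_coefficients s r1 r2 N a b alpha aj.
Hypothesis hr2 : r1 = (s * s.+1 + 2 * s)%N ->
        is_r2 r1 r2 N aj c /\ (r2 < 2 * s ^ 2 + 4 * s)%N.
Notation js := (jseq s r1 r2 N).
Notation es := (shear_exponents js).
Notation x := (@xvar R p).
Notation y := (@yvar R p).

(** In the second case the only exclusions specific to it are 2 s^2 + 4 s, which
    equals r1 + s^2 + s, and s + r2 + s^2; both are greater than r1. *)
Lemma r1_jseq : r1 \in js.
Proof.
have [_ _ _ [nres _] _] := nfc.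
have iota_r1 : r1 \in iota 1 N.-1 by rewrite mem_iota; lia.
rewrite /jseq; case: eqP => /= [eq_r1|ne_r1]; rewrite mem_filter iota_r1 nres.
  by rewrite !andbT; have [[lt12 _ _] _] := hr2 eq_r1; nia.
by rewrite !andbT; nia.
Qed.

Lemma coefficient_off_jseq (j : nat) :
  (0 < j < N)%N -> j \notin js -> aj j = 0.
Proof.
move=> range_j; have [_ _ az [_ rz] az2] := nfc.
have iota_j : j \in iota 1 N.-1 by rewrite mem_iota; lia.
rewrite /jseq; case: eqP => /= [eq_r1|ne_r1]; rewrite mem_filter iota_j andbT.
  have [_ lt2] := hr2 eq_r1; rewrite !negb_and !negbK => /or3P[/eqP ej|/eqP ej|].
  - rewrite ej (_ : 2 * s ^ 2 + 4 * s = r1 + s ^ 2 + s)%N ?az //; nia.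
  - by rewrite ej az2 //; lia.
  - by apply: rz; lia.
rewrite negb_and !negbK => /orP[/eqP ej|]; last by apply: rz; lia.
by rewrite ej az //; lia.
Qed.

(** The coefficient of A^(-1)_(e-1), with the constant alpha merged into that
    of A^(-1)_r1. *)
Definition shear_coef (e : nat) : fps R p :=
  aj (e%:Z - 1) + fps_const (alpha *+ (e == r1.+1)).

Lemma shear_exponents_uniq : uniq es.
Proof.
rewrite /= map_inj_uniq ?jseq_uniq; last exact: succn_inj.
rewrite inE negb_or /= andbT; apply/andP; split; apply/mapP => -[j] //.
by move=> /jseq_range /andP[j_gt0 _] [j0]; rewrite -j0 in j_gt0.
Qed.

Lemma shear_exponents_lt : {in es, forall e, (e < N.+1)%N}.
Proof.
move=> e; rewrite !inE => /or3P[/eqP ->|/eqP ->|/mapP[j /jseq_range lej ->]].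
- by [].
- by rewrite ltnS; apply: leq_trans hN.
by case/andP: lej.
Qed.

Lemma shear_coef_off e : (e < N.+1)%N -> e \notin es -> shear_coef e = 0.
Proof.
case: e => [|[|j]]; rewrite ?inE // => ltj.
rewrite !negb_or /= => notj; have j_js : j.+1 \notin js.
  by apply: contra notj => j_js; apply/mapP; exists j.+1.
rewrite /shear_coef (_ : j.+2%:Z - 1 = j.+1%:Z); last by lia.
rewrite coefficient_off_jseq ?eqSS //.
case: eqP => [def_j|_]; last by rewrite mulr0n rmorph0 addr0.
by rewrite def_j r1_jseq in j_js.
Qed.

Lemma shear_sum :
  cst alpha * y ^+ r1.+1 + \sum_(i < N.+1) par (aj (i%:Z - 1)) * y ^+ i
    = \sum_(e <- es) par (shear_coef e) * y ^+ e.
Proof.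
rewrite -(sum_support (n := N.+1) (H := fun e => par (shear_coef e) * y ^+ e)).
- under [RHS]eq_bigr do rewrite /shear_coef rmorphD /= par_const mulrDl.
  rewrite big_split addrC /=; congr (_ + _).
  have lt_r1 : (r1.+1 < N.+1)%N by lia.
  rewrite (bigD1 (Ordinal lt_r1)) //= eqxx mulr1n big1 ?addr0 // => i ne_i.
  rewrite (_ : (i == r1.+1 :> nat) = false); last exact/negbTE.
  by rewrite mulr0n cst0 mul0r.
- exact: shear_exponents_uniq.
- exact: shear_exponents_lt.
by move=> e lt_e /shear_coef_off -> //; rewrite rmorph0 mul0r.
Qed.

Lemma nf_truncatedE : nf_truncated s r1 N a b alpha aj
  = vf (\sum_(i < s.-1) par (b i) * (x * y ^+ i) + x * y ^+ s
          + \sum_(e <- es) par (shear_coef e) * y ^+ e)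
       (- (par a * x) + \sum_(i < s.-1) par (b i) * y ^+ i.+1 + y ^+ s.+1).
Proof.
rewrite -shear_sum /nf_truncated fA_rotation fA_shear_nat fB_radial.
under [\sum_(i < s.-1) _ *: _]eq_bigr do rewrite fB_radial vfZ.
under [\sum_(i < N.+1) _ *: _]eq_bigr do rewrite fA_shear vfZ mulr0.
rewrite !vf_sum !vfZ !vfD !mulr0 add0r big1_eq !addr0 mulrN.
by rewrite !addrA.
Qed.

Lemma nf_tailE (d : nat -> fps R p) :
  nf_tail N d = vf (fps_sum (fun i => par (d (N + i)%N) * y ^+ (N + i).+1)) 0.
Proof.
apply: vf_eqP; rewrite [LHS]mxE ?vfE0 ?vfE1; apply/funext => m.
  by apply: eq_bigr => i _; rewrite fA_shear_nat vfZ mxE.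
rewrite fps0; apply: big1 => i _.
by rewrite fA_shear_nat vfZ vfE1 mulr0 fps0.
Qed.

Hypothesis stat_a : forall i, fps_deriv i a 0%MM = 0.

(** Numbered from 0: first the coefficients of B^0_0, ..., B^0_(s-2), which vanish
    at mu = 0, then those of the shears once multiplied by a. *)
Definition new_parameter (k : nat) : fps R p :=
  if (k < s.-1)%N then b k else
  let f := a * shear_coef (nth 0%N es (k - s.-1)) in f - fps_const (f 0%MM).

Definition target_alpha (j : nat) : R := (a * shear_coef j.+1) 0%MM.

Lemma shear_coef_low e : (e <= r1)%N -> (a * shear_coef e) 0%MM = 0.
Proof.
move=> le_e; have [_ aj0 _ _ _] := nfc.
rewrite fpsM0 /shear_coef fpsD aj0; last by clear -le_e; lia.
by rewrite ltn_eqF // mulr0n rmorph0 fps0 addr0 mulr0.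
Qed.

Lemma shear_coef_r1 : (a * shear_coef r1.+1) 0%MM = alpha.
Proof.
have [[a0 _ _] aj0 _ _ _] := nfc.
rewrite fpsM0 a0 /shear_coef fpsD aj0; last by clear; lia.
by rewrite eqxx mulr1n fps_constE eqxx add0r mul1r.
Qed.

Lemma new_parameter0 k : (k < size js + s + 1)%N -> new_parameter k 0%MM = 0.
Proof.
have [[_ _ b0] _ _ _ _] := nfc => _.
rewrite /new_parameter; case: ifP => [/b0 //|_].
by rewrite fpsB fps_constE eqxx subrr.
Qed.

Lemma shear_exponents_size : size es = (size js + 2)%N.
Proof. by rewrite /= size_map addn2. Qed.

Lemma new_parameter_shear l : new_parameter (s.-1 + l)
  = a * shear_coef (nth 0%N es l)
    - fps_const ((a * shear_coef (nth 0%N es l)) 0%MM).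
Proof. by rewrite /new_parameter ltnNge leq_addr /= addKn. Qed.

(** The kernel condition of [has_rank_row_free]: a times a coefficient and the
    coefficient itself have the same differential at 0, as a(0) = 1 and a is
    stationary. *)
Lemma new_parameter_stationary (v : 'rV[R]_p) :
    (forall k, (k < size js + s + 1)%N -> dirderiv0 v (new_parameter k) = 0) ->
  dmu0 (nf_truncated s r1 N a b alpha aj) v = 0.
Proof.
move=> dv0; have [[a0 _ _] _ _ _ _] := nfc.
have dva : dirderiv0 v a = 0.
  by rewrite /dirderiv0 big1 // => i _; rewrite stat_a mulr0.
have st_b (i : 'I_s.-1) : stationary v (par (b i)).
  apply: stationary_par; have := dv0 i; rewrite /new_parameter ltn_ord; apply.
  by have := ltn_ord i; lia.
have st_e e : e \in es -> stationary v (par (shear_coef e)).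
  move=> e_es; apply: stationary_par; rewrite -(dirderiv0M _ a0 dva).
  have lt_e : (s.-1 + index e es < size js + s + 1)%N.
    by have := e_es; rewrite -index_mem shear_exponents_size; lia.
  have := dv0 _ lt_e; rewrite new_parameter_shear nth_index // dirderiv0D.
  by rewrite -rmorphN dirderiv0_const addr0.
have st_x : stationary v x by apply: stationary_state.
have st_y : stationary v y by apply: stationary_state.
have st_yX k : stationary v (y ^+ k) by apply: stationaryX.
apply/matrixP => i j; rewrite nf_truncatedE dmu0E !mxE; case: ifP => _.
  apply: stationaryD; first apply: stationaryD.
  - apply: stationary_sum => k _.
    exact: (stationaryM (st_b k) (stationaryM st_x (st_yX k))).
  - exact: (stationaryM st_x (st_yX s)).
  rewrite big_seq; apply: stationary_sum => e e_es.
  exact: (stationaryM (st_e e e_es) (st_yX e)).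
apply: stationaryD (st_yX _); apply: stationaryD.
  rewrite -mulN1r -[-1](rmorphN1 (@fps_const R (2 + p))).
  exact: (stationaryM (stationary_cst v _) (stationaryM (stationary_par dva) st_x)).
by apply: stationary_sum => k _; exact: (stationaryM (st_b k) (st_yX _)).
Qed.

Lemma new_parameter_row_free :
    has_rank (dmu0 (nf_truncated s r1 N a b alpha aj)) (size js + s + 1) ->
  row_free (\matrix_(k < size js + s + 1, j < p)
               fps_deriv j (new_parameter k) 0%MM).
Proof.
apply: has_rank_row_free => v Dv; apply: new_parameter_stationary => k lt_k.
have /matrixP/(_ (Ordinal lt_k) 0) := Dv; rewrite !mxE => <-.
by apply: eq_bigr => j _; rewrite !mxE mulrC.
Qed.

Variables (phi : 'I_p -> fps R p) (q : fps R p).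
Hypothesis phi0 : forall i, phi i 0%MM = 0.
Hypothesis phiE : forall k, (k < size js + s + 1)%N ->
  par (fps_subst phi (new_parameter k)) = mu k.+1.
Hypothesis aq : fps_subst phi a * q = 1.
Let vphi i : vanish 1 (phi i). Proof. exact/vanish1P. Qed.

(** In psi_(s-1+l)(phi(mu)) = mu_(s+l), the constant subtracted from the coefficient
    moves to the right. *)
Lemma rescaled_coef l : (l < size es)%N ->
  par (fps_subst phi a) * par (fps_subst phi (shear_coef (nth 0%N es l)))
    = cst ((a * shear_coef (nth 0%N es l)) 0%MM) + mu (s + l).
Proof.
rewrite shear_exponents_size => lt_l.
rewrite -rmorphM -(fps_substM vphi).
have lt_k : (s.-1 + l < size js + s + 1)%N by lia.
have := phiE lt_k; rewrite new_parameter_shear.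
rewrite (_ : (s.-1 + l).+1 = (s + l)%N); last by lia.
move=> <-; rewrite -par_const -rmorphD /=.
rewrite -[X in par (X + _)](fps_substC vphi) -(fps_substD vphi).
by rewrite addrC subrK.
Qed.

Lemma rescaled_shear :
  \sum_(e <- es) par (fps_subst phi a) * par (fps_subst phi (shear_coef e)) * y ^+ e
  = mu s + mu s.+1 * y + \sum_(1 <= i < (size js).+1)
      (cst (target_alpha (nth 0%N js i.-1)) + mu (i + s + 1))
            * y ^+ (nth 0%N js i.-1).+1.
Proof.
transitivity (\sum_(0 <= l < size es)
    (cst ((a * shear_coef (nth 0%N es l)) 0%MM) + mu (s + l))
      * y ^+ nth 0%N es l).
  rewrite (big_nth 0%N); apply: eq_big_nat => l /andP[_ lt_l].
  exact: (congr1 (fun z => z * y ^+ nth 0%N es l) (rescaled_coef lt_l)).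
have r1_gt0 : (0 < r1)%N by lia.
rewrite shear_exponents_size addn2 big_nat_recl // big_nat_recl //.
rewrite [nth _ _ 0]/= [nth _ _ 1]/= !shear_coef_low // cst0 !add0r addn0 addn1.
rewrite expr0 expr1 mulr1 addrA big_add1; congr (_ + _).
apply: eq_big_nat => i /andP[_ lt_i].
by rewrite /= (nth_map 0%N) // (_ : (s + i.+2 = i.+1 + s + 1)%N) //; lia.
Qed.

(** Under x = q X with q = 1 / a, the second component needs no correction and the
    first one is that of the target divided by a. *)
Lemma transforms_normal_form :
  transforms phi (xscaling q) 1
    (nf_truncated s r1 N a b alpha aj + nf_tail N c)
    (target_system s js target_alpha
      + nf_tail N (fun k => fps_subst phi a * fps_subst phi (c k))).
Proof.
have AQ : par (fps_subst phi a) * par q = 1 by rewrite -rmorphM aq rmorph1.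
have QA f : par q * (par (fps_subst phi a) * f) = f.
  by rewrite mulrA [par q * _]mulrC AQ mul1r.
rewrite nf_truncatedE !nf_tailE /target_system !vfD !addr0.
pose vs := subst_values_vanish phi0 (xscaling0 q).
(* An opaque morphism: the bundled one would unfold under simplification. *)
have [S SE] : {S : {rmorphism fps R (2 + p) -> fps R (2 + p)} |
    fps_subst (subst_values phi (xscaling q)) = S} by exists (subst_rmorphism vs).
have Sx : S x = par q * x by rewrite -SE (xscaling_subst_x q phi0).
have Sy : S y = y by rewrite -SE (xscaling_subst_y q phi0).
have Sp f : S (par f) = par (fps_subst phi f).
  by rewrite -SE (subst_par phi0 (xscaling0 q)).
have Sb (i : 'I_s.-1) : S (par (b i)) = mu i.+1.
  rewrite Sp -phiE; last by have := ltn_ord i; lia.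
  by rewrite /new_parameter ltn_ord.
set A := fps_subst phi a in AQ QA *.
apply: transforms_xscaling; rewrite SE; last first.
  rewrite !rmorphD rmorphN rmorphM rmorphXn rmorph_sum /= Sp Sx Sy mulrA AQ mul1r.
  rewrite addrAC; congr (_ + _ + _); apply: eq_bigr => i _.
  by rewrite rmorphM rmorphXn /= Sb Sy.
rewrite -[RHS]QA; congr (par q * _).
rewrite !rmorphD !mulrDr; congr (_ + _); last first.
  have vF i : vanish i (par (c (N + i)%N) * y ^+ (N + i).+1).
    apply: vanishMr; apply: (vanish_le (leqW (leq_addl N i))).
    by apply: vanishX; apply/vanish1P; exact: fps_var0.
  rewrite /= -SE (fps_subst_sum vs vF) fps_mul_sum; last first.
    by move=> i; apply: (vanish_subst vs); exact: vF.
  apply/funext => m; apply: eq_bigr => i _; congr (_ m).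
  by rewrite SE [S _]rmorphM /= rmorphXn /= Sp Sy rmorphM /= mulrA.
have AQx : par A * (par q * x) = x by rewrite mulrA AQ mul1r.
rewrite -rescaled_shear -[LHS]addrA [LHS]addrC [X in X + _ = _]addrC.
congr (_ + _ + _).
- rewrite rmorph_sum mulr_sumr; apply: eq_bigr => i _ /=.
  rewrite !rmorphM rmorphXn /= Sb Sx Sy [RHS]mulrCA; congr (_ * _).
  by rewrite [RHS]mulrA AQx.
- by rewrite rmorphM rmorphXn /= Sx Sy [RHS]mulrA AQx.
rewrite rmorph_sum mulr_sumr; apply: eq_bigr => e _ /=.
by rewrite rmorphM rmorphXn /= Sp Sy [RHS]mulrA.
Qed.
End NormalFormCoefficients.

Theorem theorem5p3 (R : realType) (p s r1 r2 N : nat)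
    (v : 'cV[fps R 2]_2) (w : vfield R p)
    (hv : bt_singularity v) (hw : deformation w v)
    (hsn : exists r : nat, generalized_saddle_node s r w)
    (hr1 : (2 * s < r1)%N) (hN : (r1 < N)%N)
    (hnd : nondegenerate_perturbation s r1 r2 N w) :
  let js := jseq s r1 r2 N in
  exists (phi : 'I_p -> fps R p) (Phi : 'cV[fps R (2 + p)]_2)
         (T : fps R (2 + p)) (alpha : nat -> R) (c : nat -> fps R p),
  let u : vfield R p := target_system s js alpha in
  let uH : vfield R p := hamiltonian_part s js alpha in
  let uE : vfield R p := eulerian_part s in
  [/\ [/\ reparametrization phi, state_change Phi & time_rescaling T],
      transforms phi Phi T w (u + nf_tail N c),
      [/\ (size js + s + 1 <= p)%N, r1 \in js, alpha r1 != 0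
        & forall j : nat, j \in js -> (j < r1)%N -> alpha j = 0]
    & [/\ u = uH + uE, hamiltonian uH & eulerian uE]].
Proof.
move=> js.
have s_gt0 : (0 < s)%N.
  by case: hsn => r [Phi [a [ak [b [_ _ _ [s_gt0 _ _] _]]]]].
have [Phi [T [a [b [alpha [aj [c [[sPhi sT tw] nfc hr2 stat_a hrk]]]]]]]] := hnd.
have [[a0 alpha_neq0 _] _ _ _ _] := nfc.
have free_D := new_parameter_row_free s_gt0 hr1 hN nfc hr2 stat_a hrk.
have [phi [rphi phiE]] := reparametrization_exists (new_parameter0 nfc) free_D.
have phi0 := rphi.1; have vphi i : vanish 1 (phi i) by exact/vanish1P.
have A0 : fps_subst phi a 0%MM = 1 by rewrite fps_subst0.
have [q aq] := fps_inverse A0.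
have q0 : q 0%MM = 1.
  have := congr1 (fun f : fps R p => f 0%MM) aq.
  by rewrite /= fpsM0 A0 mul1r fps1_0.
pose L := xscaling q; have L0 := xscaling0 q.
exists phi, (pull phi L Phi), (fps_subst (subst_values phi L) T * 1),
  (target_alpha r1 a alpha aj), (fun k => fps_subst phi a * fps_subst phi (c k)).
split.
- split; [exact: rphi| |].
    exact: (state_change_comp phi0 L0 sPhi (xscaling_state_change q0)).
  by rewrite /time_rescaling mulr1 (fps_subst0 (subst_values_vanish phi0 L0)).
- apply: (transforms_comp phi0 L0 sPhi.1 tw).
  exact: (transforms_normal_form s_gt0 hr1 hN nfc hr2 phi0 phiE aq).
- split; first by rewrite -(eqP free_D) rank_leq_col.
  + exact: (r1_jseq s_gt0 hr1 hN nfc hr2).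
  + by rewrite /target_alpha (shear_coef_r1 nfc).
  + by move=> j _ lt_j; exact: (shear_coef_low nfc).
- split; [exact: target_systemE|exact: hamiltonian_hamiltonian_part|].
  exact: eulerian_eulerian_part.
Qed.
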